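(* Let $p\in(1,\infty)$, $s\in\mathbb{Z}_+$, $\alpha\in[0,\infty)$ and let $Q_0\subsetneqq\mathbb{R}^n$ be a closed cube. If $f\in JN_{(p,1,s)_\alpha}(Q_0)$, then $f-P_{Q_0}^{(s)}(f)\in L^{p,\infty}(Q_0)$ and there exists a positive constant $C_{(n,p,s)}$, depending only on $n$, $p$ and $s$, but independent of $f$, such that $$\left\|f-P_{Q_0}^{(s)}(f)\right\|_{L^{p,\infty}(Q_0)}\le C_{(n,p,s)}|Q_0|^\alpha\|f\|_{JN_{(p,1,s)_\alpha}(Q_0)}.$$
   Context: $\mathbb{Z}_+$ is the set of non-negative integers. Cubes in $\mathbb{R}^n$ have edges parallel to the coordinate axes and finite positive edge length. For $s\in\mathbb{Z}_+$, a cube $Q$ and an integrable $f$, $P_Q^{(s)}(f)$ denotes the unique polynomial of degree not greater than $s$ such that $\int_Q[f(x)-P_Q^{(s)}(f)(x)]x^\gamma\,dx=0$ for all multi-indices $\gamma\in\mathbb{Z}_+^n$ with $|\gamma|\le s$. $JN_{(p,1,s)_\alpha}(Q_0)$ is the set of $f\in L^1(Q_0)$ with $$\|f\|_{JN_{(p,1,s)_\alpha}(Q_0)}:=\sup\left\{\sum_i|Q_i|\left[|Q_i|^{-\alpha}\frac1{|Q_i|}\int_{Q_i}|f-P_{Q_i}^{(s)}(f)|\right]^p\right\}^{1/p}<\infty,$$ the supremum being over all collections of pairwise disjoint cubes $\{Q_i\}_i$ in $Q_0$. The weak Lebesgue space $L^{p,\infty}(Q_0)$ is the set of measurable $f$ with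 $\|f\|_{L^{p,\infty}(Q_0)}:=\sup_{\lambda\in(0,\infty)}\lambda|\{x\in Q_0:|f(x)|>\lambda\}|^{1/p}<\infty$. *)

(* Defs.v *)
From HB Require Import structures.
From mathcomp Require Import all_boot all_order all_algebra.
From mathcomp Require Import all_classical all_reals all_analysis.
From mathcomp Require multinomials.mpoly.

Set Implicit Arguments.
Unset Strict Implicit.
Unset Printing Implicit Defensive.

Import Order.TTheory GRing.Theory Num.Theory.
Import numFieldNormedType.Exports.

Local Open Scope classical_set_scope.
Local Open Scope ring_scope.

(* Lebesgue measure on the Borel sets of R^n = n.-tuple R, by induction on n:
   R^0 carries the Dirac mass and R^(n+1) the image of the product measure on
   R * R^n under (t, x) |-> t :: x. *)
Section borel_lebesgue.
Local Open Scope ereal_scope.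
Variable R : realType.
Local Notation mR := (measurableTypeR R).

Definition cons_pair n (x : mR * n.-tuple mR) : n.+1.-tuple mR :=
  [the n.+1.-tuple mR of x.1 :: x.2].

Lemma measurable_cons_pair n :
  measurable_fun [set: mR * n.-tuple mR] (@cons_pair n).
Proof. exact: measurable_cons. Qed.

Section step.
Variables (n : nat) (m : {sigma_finite_measure set (n.-tuple mR) -> \bar R}).

Definition lebesgue_cons : set (n.+1.-tuple mR) -> \bar R :=
  pushforward (@lebesgue_measure R \x m) (@cons_pair n).

Let lebesgue_cons0 : lebesgue_cons set0 = 0.
Proof. by rewrite /lebesgue_cons /pushforward preimage_set0 measure0. Qed.

Let lebesgue_cons_ge0 A : 0 <= lebesgue_cons A.
Proof. exact: (measure_ge0 (@lebesgue_measure R \x m)). Qed.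

Let lebesgue_cons_sigma_additive : semi_sigma_additive lebesgue_cons.
Proof.
move=> F mF tF mUF; rewrite /lebesgue_cons /pushforward preimage_bigcup.
have mpre A : measurable A -> measurable (@cons_pair n @^-1` A).
  by move=> mA; rewrite -[X in measurable X]setTI; exact: measurable_cons_pair.
apply: measure_semi_sigma_additive.
- by move=> i; exact: mpre.
- apply/trivIsetP => /= i j _ _ ij; rewrite -preimage_setI.
  by move/trivIsetP : tF => /(_ _ _ _ _ ij) ->//; rewrite preimage_set0.
- by rewrite -preimage_bigcup; exact: mpre.
Qed.

HB.instance Definition _ := isMeasure.Build _ _ _ lebesgue_cons
  lebesgue_cons0 lebesgue_cons_ge0 lebesgue_cons_sigma_additive.

Let lebesgue_cons_sigma_finite : sigma_finite setT lebesgue_cons.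
Proof.
have [F FT Foo] := sigma_finiteT (@lebesgue_measure R).
have [G GT Goo] := sigma_finiteT m.
have thead_measurable : measurable_fun setT (fun x : n.+1.-tuple mR => thead x).
  exact: measurable_tnth.
pose btail (x : n.+1.-tuple mR) : n.-tuple mR := [tuple of behead x].
have btail_measurable : measurable_fun setT btail by exact: measurable_behead.
pose H i j : set (n.+1.-tuple mR) :=
  (fun x => thead x) @^-1` F i `&` btail @^-1` G j.
have HE i j : @cons_pair n @^-1` H i j = F i `*` G j.
  apply/seteqP; split=> -[t x] /=; rewrite /H /=;
    by rewrite (_ : btail (cons_pair (t, x)) = x) //; apply/val_inj.
pose K k := if unpickle k is Some (i, j) then H i j else set0.
exists K => [|k].
  apply/esym/seteqP; split=> // x _.
  have [i _ Fi] : (\bigcup_i F i) (thead x) by rewrite -FT.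
  have [j _ Gj] : (\bigcup_j G j) (btail x) by rewrite -GT.
  by exists (pickle (i, j)) => //; rewrite /K pickleK.
rewrite /K; case: unpickle => [[i j]|]; last first.
  by split=> //; rewrite lebesgue_cons0.
have [mF Foo'] := Foo i; have [mG Goo'] := Goo j.
split; last first.
  rewrite /lebesgue_cons /pushforward HE product_measure1E//.
  by rewrite lte_mul_pinfty// ge0_fin_numE.
apply: measurableI; rewrite -[X in measurable X]setTI.
  exact: thead_measurable.
exact: btail_measurable.
Qed.

HB.instance Definition _ := Measure_isSigmaFinite.Build _ _ _ lebesgue_cons
  lebesgue_cons_sigma_finite.

End step.

Fixpoint borel_lebesgue n : {sigma_finite_measure set (n.-tuple mR) -> \bar R} :=
  match n with
  | 0 => [the {sigma_finite_measure set (0.-tuple mR) -> \bar R}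
            of \d_ [tuple]]
  | n'.+1 => [the {sigma_finite_measure set (n'.+1.-tuple mR) -> \bar R}
                of lebesgue_cons (borel_lebesgue n')]
  end.

Lemma borel_lebesgue_box n (A : 'I_n -> set mR) :
  (forall i, measurable (A i)) ->
  borel_lebesgue n [set x | forall i, A i (tnth x i)] =
  \prod_(i < n) lebesgue_measure (A i).
Proof.
elim: n A => [|n IHn] A mA.
  rewrite big_ord0 /= diracE mem_set//.
  by case.
pose B : set (n.-tuple mR) := [set x | forall i, A (lift ord0 i) (tnth x i)].
have mB : measurable B.
  rewrite (_ : B = \bigcap_(i in [set: 'I_n])
    ((fun x : n.-tuple mR => tnth x i) @^-1` A (lift ord0 i))).
    apply: fin_bigcap_measurable => [|i _]; first exact: finite_finset.
    by rewrite -[X in measurable X]setTI; exact: measurable_tnth.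
  by apply/seteqP; split=> x Bx i; [move=> _; exact: Bx|exact: (Bx i Logic.I)].
rewrite /= /lebesgue_cons /pushforward.
rewrite (_ : _ @^-1` _ = A ord0 `*` B); last first.
  apply/seteqP; split=> -[t x] /=.
    move=> Ax; split=> [|i]; first exact: (Ax ord0).
    by have := Ax (lift ord0 i); rewrite tnthS.
  move=> [At Bx] i; have [j ->|->//] := unliftP ord0 i.
  by rewrite tnthS; exact: Bx.
rewrite product_measure1E// big_ord_recl; congr mule.
exact: (IHn (fun i => A (lift ord0 i))).
Qed.

End borel_lebesgue.

Section statement_definitions.
Import (canonicals, coercions) mpoly.
Variables (R : realType) (n : nat).

(* R^n with the sigma-algebra of all Lebesgue (i.e., Caratheodory) measurable
   sets; using n.-tuple R itself would only give access to Borel sets. *)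
Definition Rn : measurableType _ :=
  caratheodory_type (mu_ext (borel_lebesgue R n)).

Definition coord (x : Rn) (i : 'I_n) : R := tnth (x : n.-tuple R) i.

Definition lebesgue_Rn : {measure set Rn -> \bar R} :=
  [the {measure set Rn -> \bar R}
     of @completed_measure_extension _ _ R (borel_lebesgue R n)].

Local Notation mu := lebesgue_Rn.

Lemma lebesgue_Rn_box (A : 'I_n -> set (measurableTypeR R)) :
  (forall i, measurable (A i)) ->
  mu [set x | forall i, A i (coord x i)] =
  (\prod_(i < n) lebesgue_measure (A i))%E.
Proof.
move=> mA; rewrite -borel_lebesgue_box//; apply: measurable_mu_extE => /=.
rewrite (_ : [set x | _] = \bigcap_(i in [set: 'I_n])
  ((fun x : n.-tuple (measurableTypeR R) => tnth x i) @^-1` A i)).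
  apply: fin_bigcap_measurable => [|i _]; first exact: finite_finset.
  by rewrite -[X in measurable X]setTI; exact: measurable_tnth.
by apply/seteqP; split=> x Ax i; [move=> _; exact: Ax|exact: (Ax i Logic.I)].
Qed.

Definition vol (Q : set Rn) : R := fine (mu Q).

(* A cube need not be open or closed: each of its faces may or may not be
   included, as governed by the booleans b i and c i. *)
Definition is_cube (Q : set Rn) : Prop :=
  exists (a : 'I_n -> R) (l : R) (b c : 'I_n -> bool), 0 < l /\
    Q = [set x | forall i,
      coord x i \in Interval (BSide (b i) (a i)) (BSide (c i) (a i + l))].

Definition is_closed_cube (Q : set Rn) : Prop :=
  exists (a : 'I_n -> R) (l : R), 0 < l /\
    Q = [set x | forall i, coord x i \in `[a i, a i + l]].

Definition polyfun (P : mpoly.mpoly n R) (x : Rn) : R :=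
  mpoly.meval (coord x) P.

(* mpoly.msize is 1 + total degree, and 0 for the zero polynomial. *)
Definition mdegree_le (s : nat) (P : mpoly.mpoly n R) : Prop :=
  (mpoly.msize P <= s.+1)%N.

Definition moments_vanish (s : nat) (Q : set Rn) (g : Rn -> R) : Prop :=
  forall gamma : 'I_n -> nat, (\sum_i gamma i <= s)%N ->
    (\int[mu]_(x in Q) (g x * \prod_i coord x i ^+ gamma i)%:E = 0)%E.

(* The unique such polynomial, for Q a cube and f integrable on Q; the default
   value 0 is only reached outside of that case. *)
Definition minpoly (s : nat) (Q : set Rn) (f : Rn -> R) : mpoly.mpoly n R :=
  xget (mpoly.mpolyC n 0)
    [set P | mdegree_le s P /\ moments_vanish s Q (f \- polyfun P)].

Definition disjoint_cubes (Q0 : set Rn) : set (set (set Rn)) :=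
  [set F | (forall Q, F Q -> is_cube Q /\ Q `<=` Q0) /\ trivIset F id].

Definition JN_term (p : R) (s : nat) (alpha : R) (f : Rn -> R) (Q : set Rn)
    : \bar R :=
  ((vol Q)%:E *
   ((vol Q `^ (- alpha))%:E *
    ((vol Q)^-1%:E *
     \int[mu]_(x in Q) `|f x - polyfun (minpoly s Q f) x|%:E)) `^ p)%E.

Definition JN_norm (p : R) (s : nat) (alpha : R) (Q0 : set Rn) (f : Rn -> R)
    : \bar R :=
  (ereal_sup [set (\esum_(Q in F) JN_term p s alpha f Q)%E
             | F in disjoint_cubes Q0] `^ p^-1)%E.

Definition JN (p : R) (s : nat) (alpha : R) (Q0 : set Rn) : set (Rn -> R) :=
  [set f | mu.-integrable Q0 (EFin \o f) /\
           (JN_norm p s alpha Q0 f < +oo)%E].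

Definition weakL_norm (p : R) (Q0 : set Rn) (g : Rn -> R) : \bar R :=
  ereal_sup [set (lambda%:E *
                  mu [set x | Q0 x /\ (lambda < `|g x|)%R] `^ p^-1)%E
            | lambda in [set lambda : R | 0 < lambda]].

Definition weakL (p : R) (Q0 : set Rn) : set (Rn -> R) :=
  [set g | measurable_fun Q0 g /\ (weakL_norm p Q0 g < +oo)%E].

End statement_definitions.

(* Main.v *)
(** Let [g = f - P] with [P] the moment-matching polynomial of [f] on [Q0], and
    let [E lam] be the union of the dyadic subcubes of [Q0] on which the mean of
    [|g|] exceeds [lam].  On a maximal such cube [Q] the mean of [|g|] is at most
    [2^n lam], because [Q] has a parent with small mean; by the reverse Hölder
    inequality for polynomials of bounded degree, the polynomials attached to [Q]
    and to [Q0] then differ on [Q] by at most a constant multiple of [lam].  So a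
    mean of [|g|] above [K lam] inside [Q] forces a mean of [|f - P_Q|] above
    [lam], and the weak (1,1) bound for the dyadic maximal function on [Q]
    controls [|E (K lam)|] in terms of the mean oscillations of [f] on the
    disjoint maximal cubes.  This gives [phi (K lam) <= phi lam / 2 + C N^p] for
    [phi lam = lam^p |E lam|], which iterates to [phi <= C N^p].  Finally [E lam]
    contains almost all of [{|g| > lam'}] for [lam < lam']. *)

Require Import Defs.
From mathcomp Require Import all_boot all_order all_algebra.
From mathcomp Require Import all_classical all_reals all_analysis.
From mathcomp Require Import measurable_realfun qpoly lra zify.
From mathcomp Require multinomials.mpoly.

Set Implicit Arguments.
Unset Strict Implicit.
Unset Printing Implicit Defensive.

Import Order.TTheory GRing.Theory Num.Theory.
Import numFieldNormedType.Exports.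

Local Open Scope classical_set_scope.
Local Open Scope ring_scope.

(** * Reverse Hölder inequality for polynomials *)

(** The iteration starts at levels up to [K] times the mean of [|g|] on [Q0], where
    [|E lam| <= |Q0|] and the family consisting of [Q0] alone suffice. It then climbs by factors [K]
    and reaches each level in finitely many steps, so the supremum of [phi] is never assumed finite,
    as absorbing [phi / 2] into it would require. The reverse Hölder constant comes from Lagrange
    interpolation at separated nodes, one coordinate at a time, and depends on [n] and [s] only. The
    exponent [alpha] enters only through [|Q|^alpha <= |Q0|^alpha], which keeps the final constant
    independent of it. Dyadic cubes are half-open, so that each generation partitions space; the
    closed [Q0] is exchanged for its half-open version, from which it differs by a null set. *)

Lemma sqr_sum_le (R : realFieldType) (n : nat) (u : 'I_n -> R) :
  (\sum_i u i) ^+ 2 <= n%:R * \sum_i u i ^+ 2.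
Proof.
have -> : (\sum_i u i) ^+ 2 = \sum_(i < n) \sum_(j < n) u i * u j.
  by rewrite expr2 mulr_suml; apply: eq_bigr => i _; rewrite mulr_sumr.
have -> : n%:R * \sum_i u i ^+ 2 =
    \sum_(i < n) \sum_(j < n) (u i ^+ 2 + u j ^+ 2) / 2.
  rewrite [RHS](eq_bigr (fun i => u i ^+ 2 *+ n / 2 + (\sum_j u j ^+ 2) / 2)); last first.
    by move=> i _; rewrite -mulr_suml big_split/= sumr_const card_ord mulrDl.
  rewrite big_split/= sumr_const card_ord -mulr_suml sumrMnl.
  set S := \sum_i _.
  by rewrite -(mulr_natl S) -(mulr_natl (S / 2)); lra.
apply: ler_sum => i _; apply: ler_sum => j _.
have := sqr_ge0 (u i - u j); nra.
Qed.

(** * One variable: Lagrange interpolation *)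

Section poly_interval.
Variable R : realType.

(** An interval of length [l] is cut into [N = 2s+3] pieces of length [d]. The outer factor [N]
    comes from [l = N d], the power [N^(2s)] from the squared Lagrange basis polynomials, one [s+1]
    from Cauchy-Schwarz over the nodes, the other from bounding each of the [s+1] nodal values by
    the whole integral. *)
Definition poly_itv_const (s : nat) : R :=
  (s.*2 + 3)%:R * (s.+1%:R ^+ 2 * (s.*2 + 3)%:R ^+ (s.*2)).

Lemma poly_itv_const_gt0 s : 0 < poly_itv_const s.
Proof. by rewrite /poly_itv_const !mulr_gt0// ?exprn_gt0// ltr0n// addnS. Qed.

(** At [x], each Lagrange basis polynomial is a product of [s] ratios [(x - t_j) / (t_i - t_j)],
    hence at most [A^s] in absolute value; [sqr_sum_le] then handles the square of the interpolation
    sum. *)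
Lemma lagrange_sqr_le (s : nat) (p : {poly R}) (t : nat -> R) (A x : R) :
  (size p <= s.+1)%N -> 0 <= A ->
  (forall i j : nat, i != j -> t i != t j) ->
  (forall i j : 'I_s.+1, i != j -> `|x - t j| <= A * `|t i - t j|) ->
  p.[x] ^+ 2 <= s.+1%:R * A ^+ s.*2 * \sum_(i < s.+1) p.[t i] ^+ 2.
Proof.
move=> sp A0 tinj tA.
have inj : injective t by move=> i j tij; apply/eqP; apply/negPn/negP => /tinj; rewrite tij eqxx.
rewrite {1}(lagrange_gen (n := s.+1) isT inj sp) horner_sum.
apply: (le_trans (sqr_sum_le _)); rewrite -mulrA ler_wpM2l ?ler0n//.
rewrite mulr_sumr; apply: ler_sum => i _.
rewrite hornerM hornerC exprMn mulrC ler_wpM2r ?sqr_ge0//.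
rewrite (lagrangeE _ inj) // hornerM hornerC !horner_prod -prodfV -big_split/=.
rewrite -real_normK ?num_real// -muln2 exprM ler_pXn2r ?nnegrE ?exprn_ge0//.
rewrite normr_prod.
have -> : A ^+ s = \prod_(j < s.+1 | j != i :> nat) A.
  by rewrite prodr_const; congr (_ ^+ _); rewrite (@cardC1 _ i) card_ord.
apply: ler_prod => j ji; rewrite normr_ge0/= !hornerXsubC normrM normfV.
rewrite mulrC ler_pdivrMr; first by apply: tA; rewrite eq_sym.
by rewrite normr_gt0 subr_eq0 tinj// eq_sym.
Qed.

(** The point [x] may be an endpoint missing from the domain of integration: the nodes lie strictly
    inside, and their separation alone makes interpolation at [x] stable. *)
Lemma poly_itv_sqr_le (s : nat) (p : {poly R}) (a l x : R) (b c : bool) :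
  (size p <= s.+1)%N -> 0 < l -> x \in `[a, a + l] ->
  ((l * p.[x] ^+ 2)%:E <= (poly_itv_const s)%:E *
   \int[@lebesgue_measure R]_(t in [set` Interval (BSide b a) (BSide c (a + l)%R)])
     (p.[t] ^+ 2)%:E)%E.
Proof.
move=> sp l0; rewrite in_itv/= => /andP[ax xal].
set J := [set` _]; set N : R := (s.*2 + 3)%:R; set d := l / N.
have N0 : 0 < N by rewrite ltr0n addnS.
have d0 : 0 < d by rewrite divr_gt0.
have lE : l = N * d by rewrite /d mulrC divfK// gt_eqF.
have cont2 : continuous (fun t : R => p.[t] ^+ 2).
  by move=> y; apply: (@cvgM _ _ _ _ (horner p) (horner p)); exact: continuous_horner.
(* The nodes minimize [p^2] on separated intervals of length [d], so that
   [d p(t_j)^2] is at most the integral of [p^2]. *)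
pose lo (j : nat) : R := a + j.*2.+1%:R * d.
have node (j : nat) : exists t : R, t \in `[lo j, lo j + d] /\
    forall y, y \in `[lo j, lo j + d] -> p.[t] ^+ 2 <= p.[y] ^+ 2.
  have [||t t1 t2] := @EVT_min R (fun t => p.[t] ^+ 2) (lo j) (lo j + d).
  - by rewrite lerDl ltW.
  - exact: continuous_subspaceT.
  - by exists t.
have [t tP] := choice node.
have tlo j : lo j <= t j <= lo j + d by have := (tP j).1; rewrite in_itv.
(* Only the pieces of odd index [2j+1], [j <= s], carry nodes, so a free piece of length [d]
   separates consecutive ones, and a free piece remains at either end. *)
have tsep i j : (i < j)%N -> d <= t j - t i.
  move=> ij; have [/andP[_ ti] /andP[tj _]] := (tlo i, tlo j).
  suff : lo i + d + d <= lo j by lra.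
  have : i.*2.+1%:R + 2%:R <= j.*2.+1%:R :> R by rewrite -natrD ler_nat; lia.
  move=> /(ler_wpM2r (ltW d0)); rewrite /lo.
  move: (i.*2.+1%:R) (j.*2.+1%:R) => u v; lra.
have tabs i j : i != j -> d <= `|t i - t j|.
  rewrite neq_ltn => /orP[] /tsep dt; last exact: le_trans (ler_norm _).
  by rewrite distrC; exact: le_trans (ler_norm _).
have in_J y : a < y < a + l -> J y.
  move=> /andP[ay yal]; rewrite /J /= in_itv.
  by apply/andP; split; apply: lteifS.
have sub_J (j : 'I_s.+1) : `[lo j, lo j + d] `<=` J.
  move=> y /=; rewrite in_itv/= => /andP[loy ylo]; apply: in_J; apply/andP; split.
    by apply: lt_le_trans loy; rewrite ltrDl mulr_gt0// ltr0n.
  apply: le_lt_trans ylo _; rewrite lE /lo -addrA ltrD2l -{2}[d]mul1r -mulrDl.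
  by rewrite ltr_pM2r// /N natr1 ltr_nat; have := ltn_ord j; lia.
have mp2 (D : set (measurableTypeR R)) : measurable_fun D (EFin \o (fun t : measurableTypeR R => p.[t] ^+ 2 : R)).
  apply/measurable_EFinP; apply: measurable_funTS.
  exact: continuous_measurable_fun.
set I : \bar R := (\int[_]_(_ in _) _)%E.
have I0 : (0 <= I)%E by apply: integral_ge0 => t' _; rewrite lee_fin sqr_ge0.
have tI (j : 'I_s.+1) : ((d * p.[t j] ^+ 2)%:E <= I)%E.
  have mlo : measurable (`[lo j, lo j + d] : set (measurableTypeR R)) by exact: measurable_itv.
  pose Ij : \bar R := (\int[@lebesgue_measure R]_(y in `[lo j, (lo j + d)%R]) (p.[y] ^+ 2)%:E)%E.
  apply: (@le_trans _ _ Ij).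
    have -> : (d * p.[t j] ^+ 2)%:E = (\int[@lebesgue_measure R]_(y in `[lo j, (lo j + d)%R])
        cst (p.[t j] ^+ 2)%:E y)%E.
      rewrite integral_cst//= lebesgue_measure_itv/= lte_fin ltrDl d0.
      by rewrite -EFinB -EFinM; congr EFin; lra.
    apply: ge0_le_integral => //.
    - by move=> y _; rewrite lee_fin sqr_ge0.
    - by move=> y ylo; rewrite lee_fin; exact: (tP j).2.
  apply: ge0_subset_integral => //; first exact: measurable_itv.
  by move=> y _; rewrite lee_fin sqr_ge0.
have C0 := poly_itv_const_gt0 s.
case: I I0 tI => [r| |]//=; last by move=> _ _; rewrite gt0_muley ?leey// lte_fin.
rewrite lee_fin => r0 tI; rewrite -EFinM lee_fin.
have tIr j : N * r >= l * p.[t (j : 'I_s.+1)] ^+ 2.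
  by rewrite lE -mulrA ler_pM2l// -lee_fin; exact: tI.
have px : p.[x] ^+ 2 <= s.+1%:R * N ^+ s.*2 * \sum_(i < s.+1) p.[t i] ^+ 2.
  apply: lagrange_sqr_le => //; rewrite ?(ltW N0)//.
    by move=> i j /tabs; apply: contraTneq => ->; rewrite subrr normr0 -ltNge.
  move=> i j ij; apply: (@le_trans _ _ l).
    have /andP[t1 t2] := tlo j.
    have : a + l >= t j.
      have : J (t j) by apply: (sub_J j); rewrite /= in_itv/= t1.
      by rewrite /J/= in_itv => /andP[_] /lteifW.
    have : a <= t j by apply: le_trans t1; rewrite lerDl mulr_ge0 ?ler0n// ltW.
    by move=> u1 u2; rewrite ler_norml; lra.
  by rewrite lE ler_pM2l//; apply: tabs.
apply: (le_trans (ler_wpM2l (ltW l0) px)).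
rewrite mulrCA; apply: (@le_trans _ _ (s.+1%:R * N ^+ s.*2 * (s.+1%:R * (N * r)))).
  rewrite ler_pM2l; last by rewrite mulr_gt0 ?exprn_gt0// ltr0n.
  rewrite mulr_sumr; apply: (@le_trans _ _ (\sum_(i < s.+1) (N * r))).
    by apply: ler_sum => i _.
  by rewrite sumr_const card_ord mulr_natl.
rewrite /poly_itv_const -/N expr2 le_eqVlt; apply/orP; left; apply/eqP; lra.
Qed.

End poly_interval.

(** * Several variables: induction on the dimension *)

Section box.
Variable R : realType.
Local Notation mR := (measurableTypeR R).

Fixpoint seppoly (s n : nat) : (n.-tuple mR -> R) -> Prop :=
  if n is n'.+1 return (n.-tuple mR -> R) -> Prop then fun F =>
    (forall y : n'.-tuple mR, exists2 p : {poly R}, (size p <= s.+1)%N &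
       forall t, F (cons_pair (t, y)) = p.[t]) /\
    (forall t, seppoly s (fun y : n'.-tuple mR => F (cons_pair (t, y))))
  else fun=> True.

Definition box n (a : 'I_n -> R) (l : R) (b c : 'I_n -> bool) : set (n.-tuple mR) :=
  [set x | forall i, tnth x i \in Interval (BSide (b i) (a i)) (BSide (c i) (a i + l))].

Lemma measurable_box n (a : 'I_n -> R) l b c : measurable (box a l b c).
Proof.
rewrite (_ : box _ _ _ _ = \bigcap_(i in [set: 'I_n])
    ((fun x : n.-tuple mR => tnth x i) @^-1`
       [set` Interval (BSide (b i) (a i)) (BSide (c i) (a i + l))])).
  apply: fin_bigcap_measurable => [|i _]; first exact: finite_finset.
  by rewrite -[X in measurable X]setTI; apply: measurable_tnth => //; exact: measurable_itv.
by apply/seteqP; split=> x Bx i; [move=> _; exact: Bx|exact: (Bx i Logic.I)].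
Qed.

Lemma measurable_consr n (t : R) :
  measurable_fun setT (fun y : n.-tuple mR => cons_pair (t, y)).
Proof.
apply: (measurableT_comp (@measurable_cons_pair R n)).
exact: pair1_measurable.
Qed.

Lemma box_sqr_le (s n : nat) (F : n.-tuple mR -> R) (a : 'I_n -> R) (l : R)
    (b c : 'I_n -> bool) (x : n.-tuple mR) :
  measurable_fun setT F -> seppoly s F -> 0 < l ->
  (forall i, tnth x i \in `[a i, a i + l]) ->
  ((l ^+ n * F x ^+ 2)%:E <= (poly_itv_const R s ^+ n)%:E *
     \int[borel_lebesgue R n]_(y in box a l b c) (F y ^+ 2)%:E)%E.
Proof.
move=> + + l0; elim: n => [|n IHn] in F a b c x *.
  move=> mF _ _; rewrite !expr0 mul1r mul1e.
  rewrite (_ : box a l b c = setT); last by apply/seteqP; split => // y _ [].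
  rewrite integral_dirac//=; last first.
    by apply/measurable_EFinP; exact: measurable_funX.
  by rewrite diracT mul1e tuple0.
move=> mF [pF sF] xa.
have C0 := poly_itv_const_gt0 R s; set C := poly_itv_const R s in C0 *.
set J := [set` Interval (BSide (b ord0) (a ord0)) (BSide (c ord0) (a ord0 + l))] : set mR.
have mJ : measurable J by exact: measurable_itv.
pose a' := a \o lift ord0; pose b' := b \o lift ord0; pose c' := c \o lift ord0.
set Q' := box a' l b' c'.
have mQ' : measurable Q' by exact: measurable_box.
have mF2 : measurable_fun setT (fun y => (F y ^+ 2)%:E).
  by apply/measurable_EFinP; exact: measurable_funX.
(* Extension by zero, so that Tonelli applies on the full product space. *)
pose H : mR * n.-tuple mR -> \bar R := (fun z => (F (cons_pair z) ^+ 2)%:E) \_ (J `*` Q').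
have mH : measurable_fun setT H.
  apply/(measurable_restrictT _ _).1 => //; first exact: measurableX.
  apply: measurable_funTS; apply: (measurableT_comp mF2); exact: measurable_cons_pair.
have H0 z : (0 <= H z)%E.
  by rewrite /H patchE; case: ifP => // _; rewrite lee_fin sqr_ge0.
have HE y : Q' y -> (\int[@lebesgue_measure R]_t H (t, y) =
    \int[@lebesgue_measure R]_(t in J) (F (cons_pair (t, y)) ^+ 2)%:E)%E.
  move=> Q'y; rewrite [RHS]integral_mkcond; apply: eq_integral => t _.
  rewrite /H !patchE; congr (if _ then _ else _).
  by apply/idP/idP; rewrite !inE => //= -[].
have HE0 y : ~ Q' y -> (\int[@lebesgue_measure R]_t H (t, y) = 0)%E.
  move=> Q'y; rewrite integral0_eq// => t _.
  by rewrite /H patchE; case: ifP => //; rewrite inE => -[].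
have -> : (\int[borel_lebesgue R n.+1]_(y in box a l b c) (F y ^+ 2)%:E =
    \int[borel_lebesgue R n]_(y in Q')
      \int[@lebesgue_measure R]_(t in J) (F (cons_pair (t, y)) ^+ 2)%:E)%E.
  transitivity (\int[@lebesgue_measure R \x borel_lebesgue R n]_z H z)%E.
    rewrite /= /lebesgue_cons ge0_integral_pushforward//=.
    - rewrite integral_mkcond; apply: eq_integral => -[t y] _.
      rewrite /H !patchE/=; congr (if _ then _ else _).
      apply/idP/idP; rewrite !inE => //=.
        move=> Q; split; first exact: (Q ord0).
        by move=> i; have := Q (lift ord0 i); rewrite tnthS.
      move=> [Jt Q'y] i; have [j ->|->//] := unliftP ord0 i.
      by rewrite tnthS; exact: Q'y.
    - exact: measurable_cons_pair.
    - exact: measurable_box.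
    - exact: measurable_funTS.
    - by move=> y _; rewrite lee_fin sqr_ge0.
  rewrite (fubini_tonelli2 H)// [RHS]integral_mkcond; apply: eq_integral => y _.
  by rewrite patchE; case: ifPn; rewrite ?inE ?notin_setE => yQ; [exact: HE|exact: HE0].
have x'a i : tnth (behead_tuple x) i \in `[a' i, a' i + l].
  by have := xa (lift ord0 i); rewrite [x in tnth x _]tuple_eta tnthS.
have xE : x = cons_pair (thead x, behead_tuple x) by rewrite {1}(tuple_eta x); exact/val_inj.
have mFx : measurable_fun setT (fun y : n.-tuple mR => F (cons_pair (thead x, y))).
  by apply: (measurableT_comp mF); exact: measurable_consr.
have IH := IHn _ a' b' c' (behead_tuple x) mFx (sF (thead x)) x'a.
rewrite exprS -mulrA EFinM.
apply: (@le_trans _ _ (l%:E * ((C ^+ n)%:E * \int[borel_lebesgue R n]_(y in Q') (F (cons_pair (thead x, y)) ^+ 2)%:E))%E).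
  by rewrite lee_wpmul2l// ?lee_fin ?(ltW l0)// {1}xE.
rewrite muleCA exprSr EFinM -muleA lee_wpmul2l ?lee_fin ?exprn_ge0 ?(ltW C0)//.
have mG : measurable_fun Q' (fun y => \int[@lebesgue_measure R]_(t in J) (F (cons_pair (t, y)) ^+ 2)%:E)%E.
  apply: (eq_measurable_fun (fubini_G (@lebesgue_measure R) H)); last first.
    by apply: measurable_funTS; exact: measurable_fun_fubini_tonelli_G.
  by move=> y; rewrite inE; exact: HE.
have mFx2 : measurable_fun Q' (fun y => (F (cons_pair (thead x, y)) ^+ 2)%:E).
  by apply/measurable_EFinP; apply: measurable_funX; exact: measurable_funTS.
have G0 y : (0 <= \int[@lebesgue_measure R]_(t in J) (F (cons_pair (t, y)) ^+ 2)%:E)%E.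
  by apply: integral_ge0 => t _; rewrite lee_fin sqr_ge0.
rewrite -ge0_integralZl_EFin ?(ltW l0)//; last by move=> y _; rewrite lee_fin sqr_ge0.
rewrite -ge0_integralZl_EFin ?(ltW C0)//.
apply: ge0_le_integral => //.
- by move=> y _; rewrite -EFinM lee_fin mulr_ge0 ?sqr_ge0// ltW.
- exact: measurable_funeM.
- exact: measurable_funeM.
- move=> y Q'y; have [p sp pE] := pF y.
  rewrite pE -EFinM; under eq_integral do rewrite pE.
  by apply: poly_itv_sqr_le => //; exact: (xa ord0).
Qed.
End box.

(** * From Borel sets to Lebesgue measurable sets *)

Section transfer.
Import (canonicals) mpoly.
Variable R : realType.
Local Notation mR := (measurableTypeR R).

(** Freezing the head [t] multiplies coefficients by powers of [t] and shifts exponents, which may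
    merge distinct monomials. Arbitrary indices with functions [k] and [e] keep the sum in the same
    form throughout the induction. *)
Lemma seppoly_sum (s n : nat) (T : eqType) (r : seq T) (k : T -> R) (e : T -> 'I_n -> nat) :
  (forall m i, m \in r -> (e m i <= s)%N) ->
  seppoly s (fun x : n.-tuple mR => \sum_(m <- r) k m * \prod_i tnth x i ^+ e m i).
Proof.
elim: n => [//|n IHn] in k e *.
move=> es; split=> [y|t].
  exists (\sum_(m <- r) (k m * \prod_i tnth y i ^+ e m (lift ord0 i)) *: 'X^(e m ord0)).
    rewrite big_seq; elim/big_ind : _ => [|p q ps qs|m mr]; first by rewrite size_poly0.
      by rewrite (leq_trans (size_polyD _ _))// geq_max ps.
    by rewrite (leq_trans (size_scale_leq _ _))// size_polyXn ltnS es.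
  move=> t; rewrite horner_sum; apply: eq_bigr => m _.
  rewrite hornerZ hornerXn big_ord_recl -mulrA; congr (_ * _).
  by rewrite mulrC; congr (_ * _); apply: eq_bigr => i _; rewrite tnthS.
have := IHn (fun m => k m * t ^+ e m ord0) (fun m => e m \o lift ord0).
have -> : (fun x : n.-tuple mR => \sum_(m <- r) (k m * t ^+ e m ord0) *
      \prod_i tnth x i ^+ (e m \o lift ord0) i) =
   (fun y : n.-tuple mR => \sum_(m <- r) k m * \prod_i tnth (cons_pair (t, y)) i ^+ e m i).
  apply/funext => x; apply: eq_bigr => m _; rewrite -mulrA big_ord_recl; congr (_ * (_ * _)).
  by apply: eq_bigr => i _; rewrite tnthS.
by apply => m i mr; exact: es.
Qed.

Variable n : nat.
Local Notation mu := (lebesgue_Rn R n).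

Lemma measurable_borel_Rn (B : set (n.-tuple mR)) :
  measurable B -> measurable (B : set (Rn R n)).
Proof. by move=> mB; apply: sub_caratheodory; exact: sub_sigma_algebra. Qed.

Lemma measurable_fun_id_Rn :
  measurable_fun setT (id : Rn R n -> n.-tuple mR).
Proof. by move=> _ B mB; rewrite setTI; exact: measurable_borel_Rn. Qed.

(** The identity from [Rn] to tuples is measurable and pushes [mu] forward to the Borel measure,
    since the two agree on Borel sets. *)
Lemma integral_borel_Rn (D : set (n.-tuple mR)) (h : n.-tuple mR -> \bar R) :
  measurable D -> measurable_fun setT h -> (forall x, 0 <= h x)%E ->
  (\int[borel_lebesgue R n]_(y in D) h y = \int[mu]_(y in D) h y)%E.
Proof.
move=> mD mh h0.
transitivity (\int[pushforward mu (id : Rn R n -> n.-tuple mR)]_(y in D) h y)%E.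
  apply: (@eq_measure_integral _ _ _ D (pushforward mu (id : Rn R n -> n.-tuple mR))) => [|mphi A mA _].
    exact: measurable_fun_id_Rn.
  by apply/esym; exact: measurable_mu_extE.
apply: (ge0_integral_pushforward measurable_fun_id_Rn mu mD).
  exact: measurable_funTS.
by move=> y _; exact: h0.
Qed.

Lemma polyfunE (P : mpoly.mpoly n R) (x : Rn R n) :
  polyfun P x = \sum_(m <- mpoly.msupp P) mpoly.mcoeff m P *
    \prod_i tnth (x : n.-tuple R) i ^+ mpoly.fun_of_multinom m i.
Proof. by rewrite /polyfun mpoly.mevalE. Qed.

Lemma measurable_polyfun_borel (P : mpoly.mpoly n R) :
  measurable_fun setT (polyfun P : n.-tuple mR -> R).
Proof.
rewrite (_ : polyfun P = fun x : n.-tuple mR => \sum_(m <- mpoly.msupp P) mpoly.mcoeff m P *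
    \prod_i tnth x i ^+ mpoly.fun_of_multinom m i); last first.
  by apply/funext => x; rewrite polyfunE.
apply: measurable_sum => m; apply: measurable_funM => //.
by apply: measurable_prod => i _; apply: measurable_funX; exact: measurable_tnth.
Qed.

Lemma measurable_polyfun (P : mpoly.mpoly n R) :
  measurable_fun setT (polyfun P : Rn R n -> R).
Proof.
apply: (measurableT_comp (measurable_polyfun_borel P)); exact: measurable_fun_id_Rn.
Qed.

Lemma measurable_cube (Q : set (Rn R n)) : is_cube Q -> measurable Q.
Proof.
by move=> [a [l [b [c [l0 ->]]]]]; apply: measurable_borel_Rn; exact: measurable_box.
Qed.

Lemma lebesgue_Rn_cube (a : 'I_n -> R) (l : R) b c : 0 < l ->
  mu (box a l b c) = (l ^+ n)%:E.
Proof.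
move=> l0; have := @lebesgue_Rn_box R n
  (fun i => [set` Interval (BSide (b i) (a i)) (BSide (c i) (a i + l))]).
move=> /= -> => [|i]; last exact: measurable_itv.
rewrite (eq_bigr (fun=> l%:E)) => [|i _]; first by rewrite prodEFin prodr_const card_ord.
by rewrite lebesgue_measure_itv/= lte_fin ltrDl l0 -EFinB addrAC subrr add0r.
Qed.

Lemma polyfun_sqr_le (s : nat) (P : mpoly.mpoly n R) (a : 'I_n -> R) (l : R) b c (x : Rn R n) :
  mdegree_le s P -> 0 < l -> (forall i, Defs.coord x i \in `[a i, a i + l]) ->
  ((l ^+ n * polyfun P x ^+ 2)%:E <= (poly_itv_const R s ^+ n)%:E *
     \int[mu]_(y in box a l b c) (polyfun P y ^+ 2)%:E)%E.
Proof.
move=> Ps l0 xa; rewrite -integral_borel_Rn.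
- apply: box_sqr_le => //; first exact: measurable_polyfun_borel.
  rewrite (_ : polyfun P = fun x : n.-tuple mR => \sum_(m <- mpoly.msupp P)
      mpoly.mcoeff m P * \prod_i tnth x i ^+ mpoly.fun_of_multinom m i); last first.
    by apply/funext => y; rewrite polyfunE.
  apply: (@seppoly_sum s n _ (mpoly.msupp P) (fun m => mpoly.mcoeff m P)
    (@mpoly.fun_of_multinom n)) => m i /mpoly.msize_mdeg_lt mP.
  have := leq_trans mP Ps; rewrite ltnS mpoly.mdegE; apply: leq_trans.
  by rewrite (bigD1 i)//= leq_addr.
- exact: measurable_box.
- apply/measurable_EFinP; apply: measurable_funX; exact: measurable_polyfun_borel.
- by move=> y; rewrite lee_fin sqr_ge0.
Qed.

Lemma polyfun_bounded (P : mpoly.mpoly n R) (Q : set (Rn R n)) : is_cube Q ->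
  [bounded polyfun P x | x in Q].
Proof.
move=> [a [l [b [c [l0 ->]]]]].
exists (\sum_(m <- mpoly.msupp P) `|mpoly.mcoeff m P| *
    \prod_i (`|a i| + l) ^+ mpoly.fun_of_multinom m i); split; first exact: num_real.
move=> M ltM y Qy; apply: le_trans (ltW ltM); rewrite polyfunE.
apply: (le_trans (ler_norm_sum _ _ _)); apply: ler_sum => m _.
rewrite normrM ler_wpM2l// normr_prod; apply: ler_prod => i _.
rewrite normr_ge0/= normrX; apply: lerXn2r; rewrite ?nnegrE ?addr_ge0// ?(ltW l0)//.
have /andP[/lteifW ay /lteifW yal] : (a i < tnth (y : n.-tuple R) i ?<= if b i) &&
    (tnth (y : n.-tuple R) i < a i + l ?<= if ~~ c i) by have := Qy i; rewrite in_itv.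
have := ler_norm (a i); have := ler_norm (- a i); rewrite normrN => a1 a2.
by rewrite ler_norml; apply/andP; split; lra.
Qed.

Lemma integrable_polyfunM (P : mpoly.mpoly n R) (Q : set (Rn R n)) (h : Rn R n -> R) :
  is_cube Q -> mu.-integrable Q (EFin \o h) ->
  mu.-integrable Q (EFin \o (h \* polyfun P)).
Proof.
move=> cQ ih; have mQ := measurable_cube cQ.
have := @integrableMl _ _ _ mu Q mQ (EFin \o h) (polyfun P) ih.
apply; last exact: polyfun_bounded.
by apply: measurable_funTS; exact: measurable_polyfun.
Qed.

Lemma integrable_polyfun (P : mpoly.mpoly n R) (Q : set (Rn R n)) :
  is_cube Q -> mu.-integrable Q (EFin \o polyfun P).
Proof.
move=> cQ; apply: measurable_bounded_integrable; first exact: measurable_cube.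
- by move: cQ => [a [l [b [c [l0 ->]]]]]; rewrite lebesgue_Rn_cube// ltry.
- by apply: measurable_funTS; exact: measurable_polyfun.
- exact: polyfun_bounded.
Qed.

Lemma integrable_dist_polyfun (P : mpoly.mpoly n R) (Q : set (Rn R n)) (h : Rn R n -> R) :
  is_cube Q -> mu.-integrable Q (EFin \o h) ->
  mu.-integrable Q (EFin \o (fun x => `|h x - polyfun P x|)).
Proof.
move=> cQ ih; have mQ := measurable_cube cQ.
apply: (@integrable_norm _ _ _ _ _ (h \- polyfun P)).
rewrite (_ : _ \o _ = (EFin \o h) \- (EFin \o polyfun P))%E//.
by apply: integrableB => //; exact: integrable_polyfun.
Qed.

End transfer.

(** * Moment-matching polynomials *)

Section minpoly_existence.
Import (canonicals) mpoly.
Variables (R : realType) (n : nat).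
Local Notation mu := (lebesgue_Rn R n).
Implicit Types (P : mpoly.mpoly n R) (Q : set (Rn R n)) (h : Rn R n -> R).

Definition lincomb N (X : 'I_N -> mpoly.mpoly n R) (v : 'I_N -> R) : mpoly.mpoly n R :=
  \sum_i v i *: X i.

Lemma polyfun_lincomb N (X : 'I_N -> mpoly.mpoly n R) v x :
  polyfun (lincomb X v) x = \sum_i v i * polyfun (X i) x.
Proof.
rewrite /polyfun /lincomb (big_morph _ (mpoly.mevalD _) (mpoly.meval0 _)).
by apply: eq_bigr => i _; rewrite mpoly.mevalZ.
Qed.

Lemma mdegree_le_lincomb s N (X : 'I_N -> mpoly.mpoly n R) v :
  (forall i, mdegree_le s (X i)) -> mdegree_le s (lincomb X v).
Proof.
move=> Xs; apply: (leq_trans (mpoly.mmeasure_sum _ _ _ _)).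
apply/bigmax_leqP => i _; apply: leq_trans (Xs i); exact: mpoly.msizeZ_le.
Qed.

Lemma polyfunB P1 P2 x : polyfun (P1 - P2) x = polyfun P1 x - polyfun P2 x.
Proof. by rewrite /polyfun mpoly.mevalB. Qed.

Lemma mdegree_leB s P1 P2 : mdegree_le s P1 -> mdegree_le s P2 -> mdegree_le s (P1 - P2).
Proof.
move=> s1 s2; apply: (leq_trans (mpoly.msizeD_le _ _)); rewrite geq_max.
by apply/andP; split => //; rewrite mpoly.msizeN.
Qed.

Lemma Rintegral_lincomb Q h N (X : 'I_N -> mpoly.mpoly n R) v : is_cube Q ->
  mu.-integrable Q (EFin \o h) ->
  \int[mu]_(x in Q) (h x * polyfun (lincomb X v) x) =
  \sum_i v i * \int[mu]_(x in Q) (h x * polyfun (X i) x).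
Proof.
move=> cQ ih; have mQ := measurable_cube cQ.
have ihX i : mu.-integrable Q (EFin \o (h \* polyfun (X i))) by exact: integrable_polyfunM.
rewrite /Rintegral; under eq_integral.
  move=> x _; rewrite polyfun_lincomb mulr_sumr -sumEFin.
  under eq_bigr do rewrite mulrCA EFinM.
  over.
rewrite integral_sum//; last by move=> i; apply: integrableZl => //; exact: ihX.
rewrite -sum_fine; last first.
  by move=> i _; apply: integrable_fin_num => //; apply: integrableZl => //; exact: ihX.
apply: eq_bigr => i _; rewrite integralZl//; last exact: ihX.
by rewrite fineM//; exact: (integrable_fin_num _ (ihX i)).
Qed.

(** The pointwise reverse Hölder bound yields vanishing at every point of [Q], not merely almost
    everywhere. *)
Lemma polyfun_sqr_eq0 s P Q : is_cube Q -> mdegree_le s P ->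
  \int[mu]_(x in Q) (polyfun P x * polyfun P x) = 0 -> forall x, Q x -> polyfun P x = 0.
Proof.
move=> cQ Ps int0 x Qx; have mQ := measurable_cube cQ.
have iPP : mu.-integrable Q (EFin \o (polyfun P \* polyfun P)).
  by apply: integrable_polyfunM => //; exact: integrable_polyfun.
move: cQ => [a [l [b [c [l0 QE]]]]].
have := @polyfun_sqr_le R n s P a l b c x Ps l0; move: QE; rewrite -/(box a l b c) => QE.
rewrite -QE (_ : integral _ _ _ = 0%E); last first.
  have := fineK (integrable_fin_num mQ iPP).
  by move: int0; rewrite /Rintegral => /= -> <-.
rewrite mule0 lee_fin => Hx; apply/eqP; rewrite -sqrf_eq0 eq_le sqr_ge0 andbT.
have ln0 : 0 < l ^+ n by exact: exprn_gt0.
rewrite -(ler_pM2l ln0) mulr0; apply: Hx => i.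
have := Qx; rewrite QE => /(_ i); rewrite !in_itv/= => /andP[/lteifW -> /lteifW].
by [].
Qed.

(* Symmetric Gram matrices need not be shown invertible: a column [w] of the
   cokernel of [G] satisfies [int (sum w_i X_i)^2 = 0], so [sum w_i X_i] vanishes
   on [Q] and the moment vector of [f] is orthogonal to [w]. *)
Lemma gram_solve s Q f N (X : 'I_N -> mpoly.mpoly n R) : is_cube Q ->
  mu.-integrable Q (EFin \o f) -> (forall i, mdegree_le s (X i)) ->
  exists v : 'I_N -> R, forall j, \int[mu]_(x in Q) (f x * polyfun (X j) x) =
     \int[mu]_(x in Q) (polyfun (lincomb X v) x * polyfun (X j) x).
Proof.
move=> cQ fi Xs.
pose G : 'M[R]_N := \matrix_(i, j) \int[mu]_(x in Q) (polyfun (X i) x * polyfun (X j) x).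
pose b : 'rV[R]_N := \row_j \int[mu]_(x in Q) (f x * polyfun (X j) x).
have iX P : mu.-integrable Q (EFin \o polyfun P) by exact: integrable_polyfun.
have /submxP[v vG] : (b <= G)%MS.
  rewrite submxE; apply/eqP/rowP => k; rewrite mxE [RHS]mxE.
  pose w i := cokermx G i k.
  have Gw i : \int[mu]_(x in Q) (polyfun (X i) x * polyfun (lincomb X w) x) = 0.
    rewrite Rintegral_lincomb//.
    have /matrixP/(_ i k) := mulmx_coker G; rewrite mxE [RHS]mxE => Gk.
    by rewrite -[RHS]Gk; apply: eq_bigr => j _; rewrite [G i j]mxE mulrC.
  have w0 x : Q x -> polyfun (lincomb X w) x = 0.
    apply: (@polyfun_sqr_eq0 s) => //; first exact: mdegree_le_lincomb.
    rewrite Rintegral_lincomb// big1// => i _.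
    by rewrite (eq_Rintegral _ (g := fun x => polyfun (X i) x * polyfun (lincomb X w) x));
      rewrite ?Gw ?mulr0// => y _; rewrite mulrC.
  transitivity (\int[mu]_(x in Q) (f x * polyfun (lincomb X w) x)).
    rewrite Rintegral_lincomb//; apply: eq_bigr => i _.
    by rewrite [b 0 i]mxE mulrC.
  rewrite (eq_Rintegral _ (g := cst 0)); last by move=> x; rewrite inE => /w0 ->; rewrite mulr0.
  by rewrite /Rintegral integral0.
exists (fun i => v 0 i) => j.
have /rowP/(_ j) := vG; rewrite mxE [in RHS]mxE => ->.
rewrite [RHS](eq_Rintegral _ (g := fun x => polyfun (X j) x * polyfun (lincomb X (fun i => v 0 i)) x)); last first.
  by move=> x _; rewrite mulrC.
rewrite Rintegral_lincomb//; apply: eq_bigr => i _; rewrite [G i j]mxE; congr (_ * _).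
by apply: eq_Rintegral => x _; rewrite mulrC.
Qed.

(** [xget] returns an admissible polynomial once there is one, and the Gram system for the monomials
    of degree at most [s] produces one. *)
Lemma minpolyP s Q f : is_cube Q -> mu.-integrable Q (EFin \o f) ->
  mdegree_le s (minpoly s Q f) /\ moments_vanish s Q (f \- polyfun (minpoly s Q f)).
Proof.
move=> cQ fi; rewrite /minpoly; case: xgetP => [P _ //|].
have mQ := measurable_cube cQ.
(* [bmultinom] bounds degrees strictly, whence [s.+1]. *)
pose I : finType := mpoly.bmultinom n s.+1.
pose X (i : 'I_#|I|) : mpoly.mpoly n R := mpoly.mpolyX R (mpoly.bmnm (enum_val i)).
have Xs i : mdegree_le s (X i).
  by rewrite /mdegree_le mpoly.msizeX; exact: mpoly.bmdeg.
have [v vP] := gram_solve cQ fi Xs.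
move=> /(_ (lincomb X v)); case; split; first exact: mdegree_le_lincomb.
move=> gamma gs.
pose m := mpoly.Multinom [tuple gamma i | i < n].
have ms : (mpoly.mdeg m < s.+1)%N.
  by rewrite mpoly.mdegE ltnS (eq_bigr gamma)// => i _; rewrite mpoly.mnmE.
pose j := enum_rank (mpoly.BMultinom ms : I).
have XjE x : \prod_i Defs.coord x i ^+ gamma i = polyfun (X j) x.
  rewrite /polyfun /X enum_rankK/= mpoly.mevalX.
  by apply: eq_bigr => i _; rewrite mpoly.mnmE.
under eq_integral do rewrite XjE.
have ifX : mu.-integrable Q (EFin \o (f \* polyfun (X j))) by exact: integrable_polyfunM.
have iPX : mu.-integrable Q (EFin \o (polyfun (lincomb X v) \* polyfun (X j))).
  by apply: integrable_polyfunM => //; exact: integrable_polyfun.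
rewrite (eq_integral (fun x => (f x * polyfun (X j) x)%:E -
   (polyfun (lincomb X v) x * polyfun (X j) x)%:E)%E); last first.
  by move=> x _; rewrite -EFinB -mulrBl.
rewrite integralB_EFin//.
have := vP j; rewrite /Rintegral.
rewrite -[X in (X - _)%E]fineK; last exact: (integrable_fin_num mQ ifX).
rewrite -[X in (_ - X)%E]fineK; last exact: (integrable_fin_num mQ iPX).
by move=> ->; rewrite -EFinB subrr.
Qed.

End minpoly_existence.

(** * Comparison of the attached polynomial with another one *)

Section minpoly_stability.
Import (canonicals) mpoly.
Variables (R : realType) (n : nat).
Local Notation mu := (lebesgue_Rn R n).
Implicit Types (P : mpoly.mpoly n R) (Q : set (Rn R n)) (h : Rn R n -> R).

Lemma moments_vanish_orth s Q h P : is_cube Q -> mu.-integrable Q (EFin \o h) ->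
  moments_vanish s Q h -> mdegree_le s P ->
  \int[mu]_(x in Q) (h x * polyfun P x) = 0.
Proof.
move=> cQ ih hs Ps.
pose X (i : 'I_(size (mpoly.msupp P))) : mpoly.mpoly n R :=
  mpoly.mpolyX R (tnth (in_tuple (mpoly.msupp P)) i).
pose v i := mpoly.mcoeff (tnth (in_tuple (mpoly.msupp P)) i) P.
have -> : P = lincomb X v by rewrite /lincomb {1}(mpoly.mpolyE P) big_tnth.
rewrite Rintegral_lincomb// big1// => i _.
rewrite /Rintegral.
set m := tnth (in_tuple (mpoly.msupp P)) i.
have mP : m \in mpoly.msupp P by exact: mem_tnth.
have := hs (mpoly.fun_of_multinom m).
rewrite (eq_integral (fun x => (h x * polyfun (X i) x)%:E)) => [->|x _].
- by rewrite mulr0.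
- rewrite -mpoly.mdegE -ltnS; exact: leq_trans (mpoly.msize_mdeg_lt mP) Ps.
- by rewrite /X /polyfun mpoly.mevalX.
Qed.

(** With [D] the difference of the two polynomials, the moments of [f - P] against [D] vanish, so
    [int D^2 = int (f - P0) D], which is at most [sup |D|] times [int |f - P0|]. Reverse Hölder
    bounds [|Q| (sup |D|)^2] by [C] times this, and one factor [sup |D|] cancels. *)
Lemma minpoly_stable s Q f P0 : is_cube Q -> mu.-integrable Q (EFin \o f) ->
  mdegree_le s P0 -> forall x, Q x ->
  vol Q * `|polyfun (minpoly s Q f) x - polyfun P0 x| <=
  poly_itv_const R s ^+ n * \int[mu]_(y in Q) `|f y - polyfun P0 y|.
Proof.
move=> cQ fi P0s; have [Ps PQ] := minpolyP s cQ fi.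
set P := minpoly s Q f in Ps PQ *; pose D := P - P0.
have mQ := measurable_cube cQ.
have Ds : mdegree_le s D by exact: mdegree_leB.
have iP P' : mu.-integrable Q (EFin \o polyfun P') by exact: integrable_polyfun.
have ifP P' : mu.-integrable Q (EFin \o (f \- polyfun P')).
  by rewrite (_ : _ \o _ = (EFin \o f) \- (EFin \o polyfun P'))%E//; exact: integrableB.
set C := _ ^+ n; set I := \int[mu]_(y in Q) _.
have C0 : 0 < C by rewrite exprn_gt0// poly_itv_const_gt0.
have I0 : 0 <= I by exact: Rintegral_ge0.
have V0 : 0 < vol Q.
  by move: cQ => [a [l [b [c [l0 ->]]]]]; rewrite /vol lebesgue_Rn_cube//= exprn_gt0.
have D2 (B : R) : (forall x, Q x -> `|polyfun D x| <= B) -> forall x, Q x ->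
    vol Q * polyfun D x ^+ 2 <= C * (B * I).
  move=> DB x Qx.
  have iDD : mu.-integrable Q (EFin \o (polyfun D \* polyfun D)) by exact: integrable_polyfunM.
  have ifD P' : mu.-integrable Q (EFin \o ((f \- polyfun P') \* polyfun D)) by exact: integrable_polyfunM.
  have DDE : \int[mu]_(x in Q) (polyfun D x * polyfun D x) <= B * I.
    apply: (@le_trans _ _ (\int[mu]_(x in Q) ((f x - polyfun P0 x) * polyfun D x))).
      rewrite -[leRHS]subr0 -[X in _ - X](moments_vanish_orth cQ (ifP P) PQ Ds).
      rewrite -RintegralB//; [|exact: ifD..].
      rewrite le_eqVlt; apply/orP; left; apply/eqP; apply: eq_Rintegral => y _ /=.
      by rewrite polyfunB; lra.
    rewrite -RintegralZl//; last exact: (integrable_norm (ifP P0)).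
    apply: le_Rintegral => //; first exact: ifD.
      rewrite (_ : _ \o _ = (fun y => B%:E * (EFin \o (fun y => `|f y - polyfun P0 y|%R)) y))%E//.
      by apply: integrableZl => //; exact: (integrable_norm (ifP P0)).
    move=> y Qy; apply: (le_trans (ler_norm _)).
    by rewrite normrM mulrC ler_wpM2r//; exact: DB.
  move: (cQ) => [a [l [b [c [l0 QE]]]]].
  have xa i : Defs.coord x i \in `[a i, a i + l].
    by have := Qx; rewrite QE => /(_ i); rewrite !in_itv/= => /andP[/lteifW -> /lteifW].
  have := polyfun_sqr_le b c Ds l0 xa; rewrite -/C.
  have -> : vol Q = l ^+ n by rewrite QE /vol lebesgue_Rn_cube.
  rewrite /box -QE.
  have -> : (\int[mu]_(y in Q) (polyfun D y ^+ 2)%:E =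
      (\int[mu]_(x in Q) (polyfun D x * polyfun D x))%:E)%E.
    rewrite /Rintegral fineK; last exact: (integrable_fin_num mQ iDD).
    by apply: eq_integral => y _; rewrite expr2.
  by rewrite -EFinM lee_fin => /le_trans; apply; rewrite ler_pM2l.
move=> x Qx; rewrite -polyfunB -/D.
pose A := [set `|polyfun D y| | y in Q].
have A0 : A !=set0 by exists `|polyfun D x|; exists x.
have [M [_ DM]] := polyfun_bounded D cQ.
have ubA : has_ubound A.
  by exists (M + 1) => _ [y Qy <-]; apply: DM => //; rewrite ltrDl.
have DS y : Q y -> `|polyfun D y| <= sup A.
  by move=> Qy; apply: ub_le_sup => //; exists y.
have S0 : 0 <= sup A by apply: le_trans (DS x Qx).
apply: (@le_trans _ _ (vol Q * sup A)); first by rewrite ler_pM2l// DS.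
have [-> |Sn0] := eqVneq (sup A) 0; first by rewrite mulr0 mulr_ge0// ltW.
have {S0}Sn0 : 0 < sup A by rewrite lt_neqAle eq_sym Sn0.
(* The estimate concerns [D^2] while the supremum is that of [|D|], hence the square root. *)
have Sr : sup A <= Num.sqrt (C * (sup A * I) / vol Q).
  apply: ge_sup => // _ [y Qy <-].
  rewrite -(sqrtr_sqr) ler_wsqrtr// ler_pdivlMr// mulrC.
  exact: (D2 _ DS).
have := lerXn2r 2 (ltW Sn0 : sup A \is Num.nneg) (sqrtr_ge0 _ : _ \is Num.nneg) Sr.
rewrite sqr_sqrtr; last by rewrite divr_ge0 ?mulr_ge0// ltW.
rewrite ler_pdivlMr// => H; rewrite -(ler_pM2r Sn0); nra.
Qed.
End minpoly_stability.

(** * Dyadic cubes *)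

Section dyadic.
Variables (R : realType) (n : nat) (a : 'I_n -> R) (l : R).
Hypothesis l_gt0 : 0 < l.
Local Notation mR := (measurableTypeR R).
Local Notation Rn := (Rn R n).
Local Notation mu := (lebesgue_Rn R n).
Local Notation coord := Defs.coord.
Implicit Types (x y : Rn) (j k : nat).

(** The floor makes the cells half-open, so each generation partitions all of R^n, not just the base
    cube. *)
Definition dyad_index k x (i : 'I_n) : int := Num.floor (2 ^+ k * ((coord x i - a i) / l)).

Definition dyad k x : set Rn := [set y | forall i, dyad_index k y i = dyad_index k x i].

Lemma dyad_refl k x : dyad k x x. Proof. by []. Qed.

Lemma dyad_eq k x y : dyad k x y -> dyad k y = dyad k x.
Proof. by move=> yx; apply/seteqP; split=> z zx i; rewrite (zx i) (yx i). Qed.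

(** An integer [m] is at most [w] exactly when [2m] is at most [2w], so [floor (2w)] determines
    [floor w]. Coordinatewise, this is the nesting of the generations. *)
Lemma floor_double_eq (u v : R) : Num.floor (2 * u) = Num.floor (2 * v) ->
  Num.floor u = Num.floor v.
Proof.
have floor2 (w : R) m : (m <= Num.floor w) = (2 * m <= Num.floor (2 * w)).
  by rewrite !floor_ge_int rmorphM/= ler_pM2l// ltr0n.
move=> uv; apply/eqP; rewrite eq_le (floor2 v) -uv -floor2 lexx/=.
by rewrite (floor2 u) uv -floor2.
Qed.

Lemma dyad_subset j k x : (j <= k)%N -> dyad k x `<=` dyad j x.
Proof.
move=> jk y; elim: k jk => [|k IH]; first by rewrite leqn0 => /eqP ->.
rewrite leq_eqVlt => /orP[/eqP -> //|]; rewrite ltnS => jk yx; apply: IH => // i.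
by apply: floor_double_eq; rewrite !(mulrA 2) -!exprS; exact: yx.
Qed.

Definition corner k x (i : 'I_n) : R := a i + (dyad_index k x i)%:~R * (l / 2 ^+ k).

Lemma dyadE k x : dyad k x = box (corner k x) (l / 2 ^+ k) (fun=> true) (fun=> true).
Proof.
have e0 : 0 < 2 ^+ k :> R by rewrite exprn_gt0.
have le0 : 0 < l / 2 ^+ k by rewrite divr_gt0.
have bnd (z : R) (m : int) (b : R) : (m%:~R <= 2 ^+ k * ((z - b) / l) < (m + 1)%:~R) =
    (b + m%:~R * (l / 2 ^+ k) <= z < b + m%:~R * (l / 2 ^+ k) + l / 2 ^+ k).
  have -> : 2 ^+ k * ((z - b) / l) = (z - b) / (l / 2 ^+ k) by rewrite invf_div mulrCA.
  rewrite ler_pdivlMr// ltr_pdivrMr// rmorphD/= mulrDl mul1r.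
  by rewrite lerBrDl ltrBlDl addrA.
apply/seteqP; split=> y yx i.
  by rewrite in_itv/= -bnd -[dyad_index k x i](yx i) floor_itv.
by apply/eqP; rewrite floor_eq bnd; have := yx i; rewrite in_itv.
Qed.

Lemma dyad_cube k x : is_cube (dyad k x).
Proof.
exists (corner k x), (l / 2 ^+ k), (fun=> true), (fun=> true).
by split; [rewrite divr_gt0// exprn_gt0|exact: dyadE].
Qed.

Lemma measurable_dyad k x : measurable (dyad k x).
Proof. exact/measurable_cube/dyad_cube. Qed.

Lemma lebesgue_dyad k x : mu (dyad k x) = ((l / 2 ^+ k) ^+ n)%:E.
Proof. by rewrite dyadE lebesgue_Rn_cube// divr_gt0// exprn_gt0. Qed.

Lemma dyad0 x : box a l (fun=> true) (fun=> true) x ->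
  dyad 0 x = box a l (fun=> true) (fun=> true).
Proof.
move=> ax; rewrite dyadE expr0 divr1; congr box.
apply/funext => i; rewrite /corner (_ : dyad_index 0 x i = 0) ?mul0r ?addr0//.
apply/eqP; rewrite floor_eq expr0 mul1r; have := ax i; rewrite in_itv/= => /andP[a1 a2].
by rewrite divr_ge0 ?subr_ge0 ?(ltW l_gt0)//= ltr_pdivrMr// mul1r ltrBlDl.
Qed.

Lemma dyad_dist k x y i : dyad k x y -> `|coord y i - coord x i| < l / 2 ^+ k.
Proof.
move=> yx; have := dyad_refl k x; rewrite dyadE => /(_ i).
have := yx; rewrite dyadE => /(_ i); rewrite !in_itv/= -/(coord _ _) -/(coord _ _).
by move=> /andP[y1 y2] /andP[x1 x2]; rewrite ltr_norml; lra.
Qed.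

Lemma dyad_scale_lt (e : R) : 0 < e -> exists k, l / 2 ^+ k < e.
Proof.
move=> e0; exists (Num.truncn (l / e)).+1.
rewrite ltr_pdivrMr ?exprn_gt0// -ltr_pdivrMl// mulrC.
apply: lt_trans (truncnS_gt _) _.
by rewrite -natrX ltr_nat ltn_expl.
Qed.

(** Stopping-time selection: each point keeps its coarsest cube satisfying [P], which exists because
    generations start at [0]. Two selected cubes with a common point have the same generation, hence
    coincide. [pickle] enumerates the pairs of generation and position; a code of no selected cube
    gives the empty set. *)
Lemma dyadic_select (P : set Rn -> Prop) : exists F : (set Rn)^nat,
  [/\ trivIset setT F,
      forall m, F m = set0 \/ exists k x, [/\ F m = dyad k x, P (dyad k x) &
        forall j, (j < k)%N -> ~ P (dyad j x)] &
      \bigcup_m F m = [set x | exists k, P (dyad k x)]].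
Proof.
pose first k x := P (dyad k x) /\ forall j, (j < k)%N -> ~ P (dyad j x).
pose code k x := pickle (k, [ffun i => dyad_index k x i]).
have first_dyad k x y : dyad k x y -> first k x -> first k y.
  move=> yx [Px mx]; rewrite /first (dyad_eq yx); split => // j jk.
  by rewrite (@dyad_eq j x y); [exact: mx|exact: dyad_subset (ltnW jk) _ yx].
have code_dyad k x y : dyad k x y -> code k x = code k y.
  by move=> yx; rewrite /code; do 2 f_equal; apply/ffunP => i; rewrite !ffunE yx.
have code_inj k k' x y : code k x = code k' y -> k = k' /\ dyad k x y.
  move=> /(pcan_inj pickleK)[kk]; rewrite kk => xy; split => // i.
  by move/ffunP: xy => /(_ i); rewrite !ffunE.
exists (fun m => [set y | exists k x, [/\ code k x = m, first k x & dyad k x y]]).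
split.
- apply/trivIsetP => m m' _ _ /eqP mm'; apply: contrapT => /eqP/set0P[y [[k [x [km fx yx]]] [k' [x' [km' fx' yx']]]]].
  have [fy fy'] := (first_dyad _ _ _ yx fx, first_dyad _ _ _ yx' fx').
  have kk : k = k'.
    by case: (ltngtP k k') => // kk; [case: (fy'.2 _ kk fy.1)|case: (fy.2 _ kk fy'.1)].
  by apply: mm'; rewrite -km -km' (code_dyad _ _ _ yx) (code_dyad _ _ _ yx') kk.
- move=> m; have [->|/set0P[y [k [x [km fx yx]]]]] := eqVneq [set y | exists k x, [/\ code k x = m, first k x & dyad k x y]] set0.
    by left.
  right; exists k, x; split; [|exact: fx.1|exact: fx.2].
  apply/seteqP; split=> [z [k' [x' [km' fx' zx']]]|z zx]; last by exists k, x.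
  have [kk xx'] : k' = k /\ dyad k' x' x by apply: code_inj; rewrite km' km.
  by rewrite -kk (dyad_eq xx').
- apply/seteqP; split=> [y [m _ [k [x [_ fx yx]]]]|y [k Pk]].
    by exists k; rewrite (dyad_eq yx); exact: fx.1.
  have ex : exists k, `[< P (dyad k y) >] by exists k; exact/asboolP.
  case: (ex_minnP ex) => k0 /asboolP Pk0 mk0.
  exists (code k0 y) => //; exists k0, y; split => //; split => // j jk /asboolP/mk0.
  by rewrite leqNgt jk.
Qed.

End dyadic.

(** * Outer regularity by unions of dyadic cubes *)

Section regularity.
Variables (R : realType) (n : nat) (a : 'I_n -> R) (l : R).
Hypothesis l_gt0 : 0 < l.
Local Notation mR := (measurableTypeR R).
Local Notation Rn := (Rn R n).
Local Notation mu := (lebesgue_Rn R n).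
Local Notation coord := Defs.coord.
Local Notation dyad := (dyad a l).

(** The open sets of the topology generated by the half-open dyadic cubes. It is finer than the
    Euclidean topology, has the cubes themselves among its open sets, and each open set is a
    countable disjoint union of cubes. *)
Definition dyadic_open (U : set Rn) := forall x, U x -> exists k, dyad k x `<=` U.

Lemma dyadic_open_cover (U : set Rn) : dyadic_open U ->
  exists F : (set Rn)^nat, [/\ trivIset setT F,
    forall m, F m = set0 \/ exists k x, F m = dyad k x & \bigcup_m F m = U].
Proof.
move=> oU; have [F [tF FP FU]] := dyadic_select a l (fun D => D `<=` U).
exists F; split => //.
  by move=> m; case: (FP m) => [|[k [x [? _ _]]]]; [left|right; exists k, x].
rewrite FU; apply/seteqP; split=> x; last exact: oU.
by move=> [k]; apply; exact: dyad_refl.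
Qed.

Lemma measurable_dyadic_open (U : set Rn) : dyadic_open U -> measurable U.
Proof.
move=> /dyadic_open_cover[F [_ FP <-]]; apply: bigcup_measurable => m _.
by case: (FP m) => [->|[k [x ->]]]; [exact: measurable0|exact: measurable_dyad].
Qed.

Lemma dyadic_openI (U V : set Rn) : dyadic_open U -> dyadic_open V ->
  dyadic_open (U `&` V).
Proof.
move=> oU oV x [/oU[k kU] /oV[j jV]]; exists (maxn k j) => y yx; split.
  by apply: kU; apply: dyad_subset yx; exact: leq_maxl.
by apply: jV; apply: dyad_subset yx; exact: leq_maxr.
Qed.

Lemma dyadic_open_bigcup (F : (set Rn)^nat) : (forall m, dyadic_open (F m)) ->
  dyadic_open (\bigcup_m F m).
Proof. by move=> oF x [m _ /oF[k kF]]; exists k => y /kF; exists m. Qed.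

Lemma dyadic_open_gt (i : 'I_n) (c : R) : dyadic_open [set x | c < coord x i].
Proof.
move=> x /= cx; have [|k kx] := dyad_scale_lt l (e := coord x i - c); first by rewrite subr_gt0.
exists k => y /(dyad_dist l_gt0 i); rewrite ltr_norml => /andP[+ _] /=; move: kx; lra.
Qed.

Lemma dyadic_open_lt (i : 'I_n) (c : R) : dyadic_open [set x | coord x i < c].
Proof.
move=> x /= cx; have [|k kx] := dyad_scale_lt l (e := c - coord x i); first by rewrite subr_gt0.
exists k => y /(dyad_dist l_gt0 i); rewrite ltr_norml => /andP[_ +] /=; move: kx; lra.
Qed.

Section approximation.
Variable nu : {measure set Rn -> \bar R}.
Hypothesis nu_fin : (nu setT < +oo)%E.

(* Approximation from both sides makes this class stable under complement. *)
Definition dyadic_approx (B : set Rn) := forall e : R, 0 < e -> exists U C,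
  [/\ dyadic_open U, dyadic_open (~` C), C `<=` B, B `<=` U & (nu (U `\` C) < e%:E)%E].

Lemma nonincreasing_measure_lt (E : (set Rn)^nat) (e : R) :
  (forall m, measurable (E m)) -> nonincreasing_seq E ->
  (nu (\bigcap_m E m) < e%:E)%E -> exists m, (nu (E m) < e%:E)%E.
Proof.
move=> mE dE nuE; apply: contrapT => /forallNP Ne.
have mI : measurable (\bigcap_m E m) by exact: bigcap_measurable.
have E0 : (nu (E 0%N) < +oo)%E.
  by apply: le_lt_trans nu_fin; apply: le_measure; rewrite ?inE.
have cE := nonincreasing_cvg_mu E0 mE mI dE.
move: nuE; rewrite ltNge => /negP; apply.
rewrite -(cvg_lim _ cE)//; apply: lime_ge; first by apply/cvg_ex; eexists; exact: cE.
by apply: nearW => m; rewrite leNgt; apply/negP; exact: Ne.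
Qed.

Lemma dyadic_approxC B : dyadic_approx B -> dyadic_approx (~` B).
Proof.
move=> aB e e0; have [U [C [oU oC CB BU UC]]] := aB e e0.
exists (~` C), (~` U); split => //.
- by rewrite setCK.
- exact: subsetC.
- exact: subsetC.
- by rewrite setDE setCK setIC -setDE.
Qed.

(** The half-space is itself dyadic open; from inside it is exhausted by the sets
    [coord x i >= c + 1/(m+1)], and the remaining layers have empty intersection. *)
Lemma dyadic_approx_gt (i : 'I_n) (c : R) : dyadic_approx [set x | c < coord x i].
Proof.
move=> e e0.
pose C m : set Rn := ~` [set x | coord x i < c + m.+1%:R^-1].
have mo := measurable_dyadic_open.
have mC m : measurable (C m) by apply: measurableC; apply: mo; exact: dyadic_open_lt.
have mU : measurable [set x : Rn | c < coord x i] by apply: mo; exact: dyadic_open_gt.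
have [|||m nm] := @nonincreasing_measure_lt (fun m => [set x | c < coord x i] `\` C m) e.
- by move=> m; exact: measurableD.
- apply/nonincreasing_seqP => m; apply/subsetPset; apply: setDS.
  apply: subsetC => x /= /lt_le_trans; apply.
  by rewrite lerD2l lef_pV2 ?posrE// ler_nat.
- rewrite (_ : \bigcap_m _ = set0) ?measure0 ?lte_fin//.
  apply/seteqP; split=> // x Hx; have [/= cx _] := Hx 0%N Logic.I.
  have [k kx] : exists k : nat, k.+1%:R^-1 < coord x i - c.
    exists (Num.truncn (coord x i - c)^-1).
    by rewrite invf_plt ?posrE ?subr_gt0// truncnS_gt.
  have [_] := Hx k Logic.I; apply => /=; apply/negP; rewrite -leNgt.
  by rewrite -lerBrDl ltW.
exists [set x | c < coord x i], (C m); split => //.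
- exact: dyadic_open_gt.
- by rewrite /C setCK; exact: dyadic_open_lt.
- move=> x /= /negP; rewrite -leNgt; apply: lt_le_trans.
  by rewrite ltrDl invr_gt0.
Qed.

(** The outer set is the union of all [U m], but the inner one keeps finitely many [C j], since an
    infinite union of closed sets need not be closed; continuity from above makes up for the
    truncation. *)
Lemma dyadic_approx_bigcup (B : (set Rn)^nat) : (forall m, dyadic_approx (B m)) ->
  dyadic_approx (\bigcup_m B m).
Proof.
move=> aB e e0.
have e2 : 0 < e / 2 by rewrite divr_gt0.
(* These errors sum to at most [e / 2], which leaves the strict inequality below [e]. *)
have em m : 0 < (e / 2) / (2 ^ m.+1)%:R by rewrite divr_gt0// ltr0n expn_gt0.
have /choice[U /choice[C UCP]] : forall m, exists U C,
    [/\ dyadic_open U, dyadic_open (~` C), C `<=` B m, B m `<=` U &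
     (nu (U `\` C) < ((e / 2) / (2 ^ m.+1)%:R)%:E)%E].
  by move=> m; exact: aB.
have mo := measurable_dyadic_open.
have mU m : measurable (U m) by apply: mo; have [] := UCP m.
have mC m : measurable (C m) by rewrite -[C m]setCK; apply/measurableC/mo; have [] := UCP m.
pose V := \bigcup_m U m.
have mV : measurable V by exact: bigcup_measurable.
pose E m := V `\` \big[setU/set0]_(j < m) C j.
have mE m : measurable (E m) by apply: measurableD => //; exact: bigsetU_measurable.
have [|||m nm] := @nonincreasing_measure_lt E e => //.
- apply/nonincreasing_seqP => m; apply/subsetPset; apply: setDS.
  by rewrite big_ord_recr/=; exact: subsetUl.
- apply: (@le_lt_trans _ _ (\sum_(m <oo) nu (U m `\` C m))%E).
    apply: measure_sigma_subadditive => //.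
    + by move=> m; exact: measurableD.
    + exact: bigcap_measurable.
    + move=> x Ex; have [[m _ Umx] _] := Ex 0%N Logic.I; exists m => //; split => // Cx.
      have [_] := Ex m.+1 Logic.I; apply; rewrite big_ord_recr/=; by right.
  apply: (@le_lt_trans _ _ (e / 2)%:E).
    apply: le_trans (epsilon_trick0 xpredT (ltW e2)).
    by apply: lee_nneseries => // m _; apply: ltW; have [] := UCP m.
  by rewrite lte_fin ltr_pdivrMr// ltr_pMr// ltr1n.
exists V, (\big[setU/set0]_(j < m) C j); split => //.
- by apply: dyadic_open_bigcup => j; have [] := UCP j.
- elim/big_ind : _ => [|A A' oA oA'|j _]; last by have [] := UCP j.
    by rewrite setC0 => x _; exists 0%N.
  by rewrite setCU; exact: dyadic_openI.
- rewrite -bigcup_mkord => x [j _ Cx]; exists j => //; by have [_ _ + _ _] := UCP j; apply.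
- by move=> x [j _ Bx]; exists j => //; have [_ _ _ + _] := UCP j; apply.
Qed.

(** The approximable sets form a sigma-algebra containing the half-spaces [c < coord x i], which
    generate the Borel sets. *)
Lemma dyadic_approx_borel (B : set (n.-tuple mR)) : measurable B -> dyadic_approx B.
Proof.
have a0 : dyadic_approx set0.
  move=> e e0; exists set0, set0; split=> //; last by rewrite setD0 measure0 lte_fin.
  by rewrite setC0 => x _; exists 0%N.
apply: smallest_sub.
  split => // [A aA|A aA]; first by rewrite setTD; exact: dyadic_approxC.
  exact: dyadic_approx_bigcup.
elim/big_ind : _ => [//|X Y sX sY A [/sX|/sY]//|i _ _ [A mA <-]].
rewrite setTI; have {mA} : (@RGenOInfty.G R).-sigma.-measurable A.
  by rewrite -RGenOInfty.measurableE.
move: A; apply: smallest_sub; last by move=> _ [c ->]; rewrite /= preimage_itvoy; exact: dyadic_approx_gt.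
split => [|A aA|A aA] /=; first by rewrite preimage_set0.
  by rewrite setTD preimage_setC; exact: dyadic_approxC.
by rewrite preimage_bigcup; exact: dyadic_approx_bigcup.
Qed.

End approximation.

(** As [mu] comes from an outer measure, some Borel [B] covers [A] with excess at most [e / 2]. The
    other half is spent on approximating [B] for the restriction of [mu] to [Q], a finite
    measure. *)
Lemma outer_regular (A Q : set Rn) (e : R) : dyadic_open Q -> (mu Q < +oo)%E ->
  measurable A -> A `<=` Q -> 0 < e ->
  exists U, [/\ dyadic_open U, A `<=` U, U `<=` Q & (mu U <= mu A + e%:E)%E].
Proof.
move=> oQ Qoo mA AQ e0; have mQ := measurable_dyadic_open oQ.
have Afin : mu A \is a fin_num.
  by rewrite ge0_fin_numE//; apply: le_lt_trans Qoo; apply: le_measure; rewrite ?inE.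
have e2 : 0 < e / 2 by rewrite divr_gt0.
have [_ [F [mF AF] <-] FA] := lb_ereal_inf_adherent e2 Afin.
pose B : set (n.-tuple mR) := \bigcup_m F m.
have mB : measurable B by exact: bigcup_measurable.
have mB' : measurable (B : set Rn) by exact: measurable_borel_Rn.
have BA : (mu B <= mu A + (e / 2)%:E)%E.
  apply: le_trans (ltW FA).
  rewrite (eq_eseriesr (g := fun m => mu (F m))); last first.
    by move=> m _; apply/esym; exact: measurable_mu_extE.
  by apply: measure_sigma_subadditive => // m; exact: measurable_borel_Rn.
have nuT : (mrestr mu mQ setT < +oo)%E by rewrite /mrestr setTI.
have [U [C [oU oC CB BU UC]]] := @dyadic_approx_borel _ nuT B mB (e / 2) e2.
exists (U `&` Q); split.
- exact: dyadic_openI.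
- by move=> x Ax; split; [apply: BU; exact: AF|exact: AQ].
- exact: subIsetr.
have mo := measurable_dyadic_open.
have mU : measurable U by exact: mo.
have mC : measurable C by rewrite -[C]setCK; exact/measurableC/mo.
apply: (@le_trans _ _ (mu B + mu ((U `\` C) `&` Q))%E).
  apply: (@le_trans _ _ (mu (B `|` ((U `\` C) `&` Q)))).
    apply: le_measure; rewrite ?inE.
    - exact: measurableI.
    - by apply: measurableU => //; apply: measurableI => //; exact: measurableD.
    - move=> x [Ux Qx]; have [Bx|Bx] := pselect (B x); [by left|right].
      by split => //; split => // /CB.
  by apply: measureU2 => //; apply: measurableI => //; exact: measurableD.
rewrite [e]splitr EFinD addeA; apply: leeD => //.
by apply: ltW; move: UC; rewrite /mrestr.
Qed.

End regularity.

(** * Dyadic maximal function *)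

Section dyadic_maximal.
Variables (R : realType) (n : nat) (a : 'I_n -> R) (l : R).
Hypothesis l_gt0 : 0 < l.
Local Notation Rn := (Rn R n).
Local Notation mu := (lebesgue_Rn R n).
Local Notation dyad := (dyad a l).
Local Notation dyadic_open := (dyadic_open a l).

Definition large_mean (h : Rn -> R) (lam : R) (D : set Rn) : Prop :=
  lam * vol D < \int[mu]_(x in D) h x.

(** Superlevel set of the dyadic maximal function localized to [Q]: only cubes inside [Q]
    compete. *)
Definition maximal_level (h : Rn -> R) (Q : set Rn) (lam : R) : set Rn :=
  [set x | exists k, dyad k x `<=` Q /\ large_mean h lam (dyad k x)].

Lemma maximal_level_subset h Q lam : maximal_level h Q lam `<=` Q.
Proof. by move=> x [k [kQ _]]; apply: kQ; exact: dyad_refl. Qed.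

Lemma dyadic_open_maximal_level h Q lam : dyadic_open (maximal_level h Q lam).
Proof.
by move=> x [k xk]; exists k => y yx; exists k; rewrite (dyad_eq yx).
Qed.

Lemma measurable_maximal_level h Q lam : measurable (maximal_level h Q lam).
Proof. exact/(measurable_dyadic_open l_gt0)/dyadic_open_maximal_level. Qed.

Section fixed_domain.
Variables (Q : set Rn) (h : Rn -> R).
Hypotheses (mQ : measurable Q) (Qoo : (mu Q < +oo)%E).
Hypotheses (h0 : forall x, 0 <= h x) (ih : mu.-integrable Q (EFin \o h)).

Lemma vol_fin (D : set Rn) : measurable D -> D `<=` Q -> (vol D)%:E = mu D.
Proof.
move=> mD DQ; rewrite /vol fineK// ge0_fin_numE//.
by apply: le_lt_trans Qoo; apply: le_measure; rewrite ?inE.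
Qed.

Lemma Rintegral_fin (D : set Rn) : measurable D -> D `<=` Q ->
  (\int[mu]_(x in D) h x)%:E = (\int[mu]_(x in D) (h x)%:E)%E.
Proof.
move=> mD DQ; have iD := integrableS mQ mD DQ ih.
by rewrite /Rintegral fineK//; exact: (integrable_fin_num mD iD).
Qed.

Lemma measurable_ih (D : set Rn) : measurable D -> D `<=` Q -> measurable_fun D (EFin \o h).
Proof. by move=> mD DQ; exact: (measurable_int mu (integrableS mQ mD DQ ih)). Qed.

Lemma le_integral_subset (A B : set Rn) : measurable A -> measurable B -> A `<=` B ->
  B `<=` Q -> (\int[mu]_(x in A) (h x)%:E <= \int[mu]_(x in B) (h x)%:E)%E.
Proof.
move=> mA mB AB BQ; apply: (ge0_subset_integral mu mA mB _ _ AB).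
  exact: (measurable_ih mB BQ).
by move=> x _; rewrite lee_fin.
Qed.

Lemma le_Rintegral_subset (A B : set Rn) : measurable A -> measurable B -> A `<=` B ->
  B `<=` Q -> \int[mu]_(x in A) h x <= \int[mu]_(x in B) h x.
Proof.
move=> mA mB AB BQ; have AQ : A `<=` Q by exact: subset_trans BQ.
rewrite -lee_fin (Rintegral_fin mA AQ) (Rintegral_fin mB BQ).
exact: le_integral_subset.
Qed.

Lemma integral_bigcupE (F : (set Rn)^nat) : (forall m, measurable (F m)) ->
  trivIset setT F -> \bigcup_m F m `<=` Q ->
  (\int[mu]_(x in \bigcup_m F m) (h x)%:E = \sum_(m <oo) \int[mu]_(x in F m) (h x)%:E)%E.
Proof.
move=> mF tF FQ; apply: (ge0_integral_bigcup mu mF _ _ tF).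
  by apply: measurable_ih => //; exact: bigcup_measurable.
by move=> x _; rewrite lee_fin.
Qed.

Lemma measure_bigcupE (F : (set Rn)^nat) : (forall m, measurable (F m)) ->
  trivIset setT F -> (mu (\bigcup_m F m) = \sum_(m <oo) mu (F m))%E.
Proof.
move=> mF tF; rewrite measure_bigcup//.
by apply: eq_eseriesl => m; rewrite in_setT.
Qed.

(** The coarsest cubes of large mean are disjoint and cover the level set, so summing
    [lam |F m| <= int_(F m) h] gives constant one. *)
Lemma weak_type (lam : R) : 0 <= lam ->
  lam * vol (maximal_level h Q lam) <= \int[mu]_(x in Q) h x.
Proof.
move=> lam0; have [F [tF FP FW]] := dyadic_select a l (fun D => D `<=` Q /\ large_mean h lam D).
set W := maximal_level _ _ _.
have mW : measurable W by exact: measurable_maximal_level.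
have WQ : W `<=` Q by exact: maximal_level_subset.
have FE : \bigcup_m F m = W by rewrite FW.
have mF m : measurable (F m).
  by case: (FP m) => [->|[k [x [-> _ _]]]]; [exact: measurable0|exact: measurable_dyad].
have FQ m : F m `<=` Q by move=> x Fx; apply: WQ; rewrite -FE; exists m.
rewrite -lee_fin EFinM vol_fin// Rintegral_fin//.
apply: (@le_trans _ _ (\int[mu]_(x in W) (h x)%:E)%E); last first.
  exact: (le_integral_subset mW mQ WQ (@subset_refl _ Q)).
rewrite -FE measure_bigcupE// integral_bigcupE ?FE//.
rewrite -nneseriesZl//; apply: lee_nneseries => m _; first by rewrite mule_ge0// lee_fin.
have [->|[k [x [Fm [kQ kL] _]]]] := FP m; first by rewrite measure0 mule0 integral_set0.
by rewrite -vol_fin// -Rintegral_fin// -EFinM lee_fin Fm ltW.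
Qed.

(* A cover of the exceptional set [A] by cubes meeting [A] has small means, which
   replaces the Lebesgue differentiation theorem. *)
Lemma level_set_maximal (lam lam' : R) : dyadic_open Q -> 0 <= lam -> lam < lam' ->
  (mu [set x | Q x /\ (lam' < h x)%R] <= mu (maximal_level h Q lam))%E.
Proof.
move=> oQ lam0 ll'; set W := maximal_level _ _ _; set L := [set x | _].
have mW : measurable W by exact: measurable_maximal_level.
have mL : measurable L.
  have := measurable_ih mQ (@subset_refl _ Q) mQ (emeasurable_itv `]lam'%:E, +oo[).
  congr measurable; apply/seteqP; split => x /=; rewrite in_itv/= andbT lte_fin.
    by [].
  by [].
pose A := L `\` W.
have mA : measurable A by exact: measurableD.
have AQ : A `<=` Q by move=> x [[]].
suff A0 : mu A = 0%E.
  apply: (@le_trans _ _ (mu (A `|` W))).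
    apply: le_measure; rewrite ?inE//; first exact: measurableU.
    by move=> x Lx; have [Wx|Wx] := pselect (W x); [right|left].
  apply: (@le_trans _ _ (mu A + mu W)%E); first exact: measureU2.
  by rewrite A0 add0e.
have VA : (vol A)%:E = mu A by exact: vol_fin.
have intA e : 0 < e -> lam' * vol A <= lam * (vol A + e).
  move=> e0; have [U [oU AU UQ Ue]] := outer_regular l_gt0 oQ Qoo mA AQ e0.
  have mU := measurable_dyadic_open l_gt0 oU.
  have [F [tF FP FW]] := dyadic_select a l (fun D => D `<=` U /\ D `&` A !=set0).
  pose V := \bigcup_m F m.
  have mF m : measurable (F m).
    by case: (FP m) => [->|[k [x [-> _ _]]]]; [exact: measurable0|exact: measurable_dyad].
  have mV : measurable V by exact: bigcup_measurable.
  have AV : A `<=` V.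
    move=> x Ax; rewrite /V FW; have [k kU] := oU _ (AU _ Ax).
    by exists k; split => //; exists x.
  have VU : V `<=` U by rewrite /V FW => x [k [kU _]]; apply: kU; exact: dyad_refl.
  have VQ : V `<=` Q by apply: subset_trans UQ.
  have FQ m : F m `<=` Q by move=> x Fx; apply: VQ; exists m.
  rewrite -lee_fin; apply: (@le_trans _ _ (\int[mu]_(x in A) (h x)%:E)%E).
    rewrite EFinM VA -(integral_cst mu mA); apply: (ge0_le_integral mu mA).
    - by move=> x _; rewrite lee_fin (le_trans lam0)// ltW.
    - exact: measurable_cst.
    - exact: (measurable_ih mA AQ).
    - by move=> x [[_ /ltW]]; rewrite lee_fin.
  apply: (@le_trans _ _ (\int[mu]_(x in V) (h x)%:E)%E).
    exact: (le_integral_subset mA mV AV VQ).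
  apply: (@le_trans _ _ (lam%:E * mu V)%E); last first.
    rewrite EFinM lee_wpmul2l ?lee_fin// EFinD VA; apply: le_trans Ue.
    by apply: le_measure; rewrite ?inE.
  rewrite integral_bigcupE// /V measure_bigcupE//.
  rewrite -nneseriesZl//; apply: lee_nneseries => m _.
    by move=> _; apply: integral_ge0 => x _; rewrite lee_fin.
  have [->|[k [x [Fm [kU [y [yx [_ Wy]]]] _]]]] := FP m; first by rewrite measure0 mule0 integral_set0.
  (* The cube contains a point [y] of [A], thus outside [W]; a mean above [lam] would put [y] into
     [W]. *)
  rewrite -vol_fin// -Rintegral_fin// -EFinM lee_fin leNgt; apply/negP => Fbig.
  apply: Wy; exists k; rewrite (dyad_eq yx) -Fm; split => //.
apply/eqP; rewrite -VA eqe eq_le; apply/andP; split; last first.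
  by rewrite -lee_fin VA.
rewrite leNgt; apply/negP => A0.
have [l0|ln0] := eqVneq lam 0.
  have := intA 1 ltr01; rewrite l0 mul0r; rewrite l0 in ll'.
  by rewrite leNgt mulr_gt0.
have {ln0} lam_gt0 : 0 < lam by rewrite lt_neqAle eq_sym ln0.
(* This choice makes the error [lam * e] half of the gap [(lam' - lam) |A|]; it divides by [lam], so
   [lam = 0] was treated apart. *)
have := intA ((lam' - lam) * vol A / (2 * lam)).
rewrite divr_gt0 ?mulr_gt0 ?subr_gt0// => /(_ isT).
have := subr_gt0 lam lam'; rewrite ll' => dl.
have -> : lam * (vol A + (lam' - lam) * vol A / (2 * lam)) =
    lam * vol A + (lam' - lam) * vol A / 2.
  rewrite mulrDr; congr (_ + _); rewrite invfM (mulrC 2^-1) !mulrA.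
  by rewrite -[RHS]mulr1 -(mulfV (lt0r_neq0 lam_gt0)); lra.
have : 0 < (lam' - lam) * vol A by rewrite mulr_gt0.
lra.
Qed.

End fixed_domain.
End dyadic_maximal.

(** * Good-lambda inequality *)

Lemma powR_pred (R : realType) (p u : R) : 0 < u -> u `^ p = u `^ (p - 1) * u.
Proof.
by move=> u0; rewrite -{3}(powRr1 (ltW u0)) -powRD ?subrK// (gt_eqF u0) implybT.
Qed.

(* Used instead of Hölder's inequality for the sum over the maximal cubes. *)
Lemma powR_young_le (R : realType) (p T o : R) : 1 < p -> 0 < T -> 0 <= o ->
  T `^ (p - 1) * o <= T `^ p + o `^ p.
Proof.
move=> p1 T0 o0.
have p10 : 0 <= p - 1 by rewrite subr_ge0 ltW.
have [oT|To] := leP o T.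
  by apply: (@le_trans _ _ (T `^ p)); rewrite ?lerDl ?powR_ge0// (powR_pred p T0) ler_wpM2l// powR_ge0.
apply: (@le_trans _ _ (o `^ p)); rewrite ?lerDr ?powR_ge0// (powR_pred p (lt_trans T0 To)).
by rewrite ler_wpM2r// ge0_ler_powR ?nnegrE ?(ltW To)// ltW.
Qed.

Section good_lambda_inequality.
Import (canonicals) mpoly.
Variables (R : realType) (n s : nat) (a : 'I_n -> R) (l p M : R).
Variables (f : Rn R n -> R) (P0 : mpoly.mpoly n R).
Local Notation Rn := (Rn R n).
Local Notation mu := (lebesgue_Rn R n).
Local Notation dyad := (dyad a l).
Let Q0 : set Rn := box a l (fun=> true) (fun=> true).
Let g (x : Rn) := `|f x - polyfun P0 x|.
Let E lam := maximal_level a l g Q0 lam.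
(** [K - 1] is the reverse Hölder constant times the factor [2^n] lost to the parent cube; the
    remaining [1] leaves a full [lam] for the oscillation. *)
Let K : R := 1 + poly_itv_const R s ^+ n * 2 ^+ n.

Definition mean_osc (Q : set Rn) : R :=
  (vol Q)^-1 * \int[mu]_(x in Q) `|f x - polyfun (minpoly s Q f) x|.

Hypotheses (l_gt0 : 0 < l) (p_gt1 : 1 < p).
Hypothesis (fi : mu.-integrable Q0 (EFin \o f)).
Hypothesis (P0s : mdegree_le s P0).
(** [M] will be [|Q0|^(alpha p)] times the [p]-th power of the norm. Empty terms are allowed because
    [dyadic_select] produces them. *)
Hypothesis JN_bound : forall F : (set Rn)^nat, trivIset setT F ->
  (forall m, F m = set0 \/ is_cube (F m) /\ F m `<=` Q0) ->
  (\sum_(m <oo) (vol (F m) * mean_osc (F m) `^ p)%:E <= M%:E)%E.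

Let cQ0 : is_cube Q0.
Proof. by exists a, l, (fun=> true), (fun=> true). Qed.

Let mQ0 : measurable Q0. Proof. exact: measurable_cube. Qed.

Let Q0oo : (mu Q0 < +oo)%E.
Proof. by rewrite /Q0 lebesgue_Rn_cube// ltry. Qed.

Let integrable_sub_polyfun (Q : set Rn) P : is_cube Q -> Q `<=` Q0 ->
  mu.-integrable Q (EFin \o (fun x => `|f x - polyfun P x|)).
Proof.
move=> cQ QQ0; apply: integrable_dist_polyfun => //.
exact: (integrableS mQ0 (measurable_cube cQ) QQ0 fi).
Qed.

Lemma vol_cube_gt0 (Q : set Rn) : is_cube Q -> 0 < vol Q.
Proof. by move=> [b [r [c [d [r0 ->]]]]]; rewrite /vol lebesgue_Rn_cube//= exprn_gt0. Qed.

Lemma vol_set0 : vol (set0 : set Rn) = 0.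
Proof. by rewrite /vol measure0. Qed.

Lemma vol_dyad k x : vol (dyad k x) = (l / 2 ^+ k) ^+ n.
Proof. by rewrite /vol lebesgue_dyad. Qed.

Lemma vol_dyad_parent k x : vol (dyad k x) = 2 ^+ n * vol (dyad k.+1 x).
Proof.
rewrite !vol_dyad -exprMn; congr (_ ^+ _).
by rewrite exprS invfM mulrCA mulVKf.
Qed.

Let K_gt1 : 1 < K.
Proof. by rewrite /K ltrDl mulr_gt0// exprn_gt0// poly_itv_const_gt0. Qed.

Lemma large_mean_ge h lam lam' D : lam <= lam' -> measurable D ->
  large_mean h lam' D -> @large_mean R n h lam D.
Proof. by move=> ll mD; apply: le_lt_trans; rewrite ler_wpM2r// fine_ge0. Qed.

Lemma maximal_cube_level k x lam : 0 < lam ->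
  dyad k x `<=` Q0 -> (forall j, (j < k)%N -> ~ (dyad j x `<=` Q0 /\ large_mean g lam (dyad j x))) ->
  ~ large_mean g lam Q0 -> large_mean g lam (dyad k x) ->
  dyad k x `&` E (K * lam) `<=`
    maximal_level a l (fun y => `|f y - polyfun (minpoly s (dyad k x) f) y|) (dyad k x) lam.
Proof.
move=> lam0 kQ min Q0small kbig.
set Q := dyad k x in kQ *; set P := minpoly s Q f.
have cQ : is_cube Q by exact: dyad_cube.
have dQ0 : dyad 0 x = Q0 by apply: (dyad0 l_gt0); apply: kQ; exact: dyad_refl.
(* Generation [0] is excluded: its cube is [Q0], whose mean is small. So [Q] has a parent inside
   [Q0]. *)
have [j kj] : exists j, k = j.+1.
  case: k @Q @P cQ min kQ kbig => [|k]; last by exists k.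
  by move=> Q P _ _ _ ; rewrite dQ0.
have jQ0 : dyad j x `<=` Q0 by rewrite -dQ0; exact: dyad_subset.
have Qj : Q `<=` dyad j x by rewrite /Q kj; exact: dyad_subset.
have V0 := vol_cube_gt0 cQ.
have mQ := measurable_cube cQ.
have parent : \int[mu]_(y in Q) g y <= lam * 2 ^+ n * vol Q.
  have : ~ large_mean g lam (dyad j x).
    by move=> jbig; apply: (min j); rewrite ?kj.
  move=> /negP; rewrite -leNgt vol_dyad_parent -kj mulrA; apply: le_trans.
  have cj : is_cube (dyad j x) by exact: dyad_cube.
  have ig := integrable_sub_polyfun P0 cQ0 (@subset_refl _ Q0).
  apply: (le_Rintegral_subset mQ0 _ ig mQ (measurable_cube cj) Qj jQ0).
  by move=> y; exact: normr_ge0.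
have PP0 y : Q y -> `|polyfun P y - polyfun P0 y| <= (K - 1) * lam.
  move=> Qy; have H := minpoly_stable cQ (integrableS mQ0 mQ kQ fi) P0s Qy.
  rewrite -(ler_pM2l V0); apply: (le_trans H).
  apply: (@le_trans _ _ (poly_itv_const R s ^+ n * (lam * 2 ^+ n * vol Q))).
    by rewrite ler_pM2l// exprn_gt0// poly_itv_const_gt0.
  by rewrite /K (addrC 1) addrK; lra.
move=> y [Qy [k' [kQ' big]]].
(* A coarser cube with mean above [K lam >= lam] would contradict the maximality of [Q], so the cube
   witnessing [y] lies inside [Q]. *)
have kk' : (k <= k')%N.
  rewrite leqNgt; apply/negP => kk; apply: (min _ kk).
  have yx : dyad k' x y by apply: dyad_subset Qy; exact: ltnW.
  rewrite -(dyad_eq yx); split=> //.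
  apply: large_mean_ge big; last exact: measurable_dyad.
  by rewrite ler_peMl// ltW.
have D_Q : dyad k' y `<=` Q by rewrite /Q -(dyad_eq Qy); exact: dyad_subset.
exists k'; split => //.
set D := dyad k' y in kQ' big D_Q *.
have cD : is_cube D by exact: dyad_cube.
have mD := measurable_cube cD.
have Doo : (mu D < +oo)%E by rewrite lebesgue_dyad// ltry.
have icst : mu.-integrable D (EFin \o cst ((K - 1) * lam)).
  apply: measurable_bounded_integrable => //.
  by exists `|(K - 1) * lam|; split=> [|M' /ltW ltM z _]; first exact: num_real.
have := big; rewrite /large_mean => big'.
suff : \int[mu]_(y in D) g y <= \int[mu]_(y in D) `|f y - polyfun P y| + (K - 1) * lam * vol D.
  by move: big'; nra.
rewrite /vol -Rintegral_cst// -RintegralD//; last exact: integrable_sub_polyfun.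
apply: le_Rintegral => //.
- exact: integrable_sub_polyfun.
- rewrite (_ : _ \o _ = (EFin \o (fun y => `|f y - polyfun P y|%R)) \+ (EFin \o cst ((K - 1) * lam)%R))%E//.
  by apply: integrableD => //; exact: integrable_sub_polyfun.
- move=> z Dz; have := PP0 z (D_Q z Dz); rewrite /g.
  have := ler_normD (f z - polyfun P z) (polyfun P z - polyfun P0 z).
  by rewrite addrA subrK; lra.
Qed.

Lemma maximal_level_anti h Q lam lam' : lam <= lam' ->
  maximal_level a l h Q lam' `<=` @maximal_level R n a l h Q lam.
Proof.
move=> ll x [k [kQ big]]; exists k; split => //.
by apply: large_mean_ge big => //; exact: measurable_dyad.
Qed.

(** On each maximal cube the weak type bound gives [lam |W m| <= |F m| osc], with [osc] the mean
    oscillation. The free parameter [T] splits [T^(p-1) osc] into a part charged to [|E lam|] and a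
    part charged to [M]. *)
Lemma good_lambda lam T : 0 < lam -> 0 < T -> ~ large_mean g lam Q0 ->
  T `^ (p - 1) * (lam * vol (E (K * lam))) <= T `^ p * vol (E lam) + M.
Proof.
move=> lam0 T0 Q0small.
have [F [tF FP FE]] := dyadic_select a l (fun D => D `<=` Q0 /\ large_mean g lam D).
have mE t : measurable (E t) by exact: measurable_maximal_level.
have EQ0 t : E t `<=` Q0 by exact: maximal_level_subset.
have {}FE : \bigcup_m F m = E lam by rewrite FE.
have FQ0 m : F m `<=` Q0 by move=> x Fx; apply: (EQ0 lam); rewrite -FE; exists m.
have Fcube m : F m = set0 \/ is_cube (F m).
  by case: (FP m) => [->|[k [x [-> _ _]]]]; [left|right; exact: dyad_cube].
have mF m : measurable (F m) by case: (Fcube m) => [->|/measurable_cube].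
pose W m := maximal_level a l (fun y => `|f y - polyfun (minpoly s (F m) f) y|) (F m) lam.
have mW m : measurable (W m) by exact: measurable_maximal_level.
have WF m : W m `<=` F m by exact: maximal_level_subset.
have EW : E (K * lam) `<=` \bigcup_m W m.
  move=> y Ey; have [m _ Fy] : (\bigcup_m F m) y.
    by rewrite FE; apply: maximal_level_anti Ey; rewrite ler_peMl// ltW.
  exists m => //; rewrite /W; move: Fy.
  have [->//|[k [x [Fm [kQ kbig] min]]]] := FP m.
  rewrite Fm => xy; exact: (maximal_cube_level lam0 kQ min Q0small kbig).
have volF D : measurable D -> D `<=` Q0 -> (vol D)%:E = mu D by exact: vol_fin.
have term m : T `^ (p - 1) * (lam * vol (W m)) <=
    T `^ p * vol (F m) + vol (F m) * mean_osc (F m) `^ p.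
  have [F0|cF] := Fcube m.
    have -> : W m = set0 by apply/seteqP; split => // x /WF; rewrite F0.
    by rewrite F0 vol_set0 !mulr0 mul0r addr0.
  have V0 := vol_cube_gt0 cF.
  have ifm := integrable_sub_polyfun (minpoly s (F m) f) cF (FQ0 m).
  have Foo : (mu (F m) < +oo)%E by rewrite -volF// ltry.
  have wt : lam * vol (W m) <= vol (F m) * mean_osc (F m).
    rewrite /mean_osc mulrA mulfV ?gt_eqF// mul1r.
    exact: (weak_type a l_gt0 (mF m) Foo (fun y => normr_ge0 _) ifm (ltW lam0)).
  have o0 : 0 <= mean_osc (F m).
    by rewrite mulr_ge0 ?invr_ge0 ?(ltW V0)// Rintegral_ge0.
  apply: (le_trans (ler_wpM2l (powR_ge0 _ _) wt)).
  rewrite mulrCA -(mulrC (vol (F m))) -mulrDr ler_pM2l//.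
  exact: powR_young_le.
pose c := T `^ (p - 1) * lam.
have c0 : 0 <= c by rewrite mulr_ge0 ?powR_ge0// ltW.
rewrite mulrA -/c -lee_fin EFinD !EFinM !volF//.
apply: (@le_trans _ _ (c%:E * \sum_(m <oo) mu (W m))%E).
  rewrite lee_wpmul2l ?lee_fin//; apply: measure_sigma_subadditive => //.
rewrite -nneseriesZl//.
apply: (@le_trans _ _ (\sum_(m <oo) ((T `^ p)%:E * mu (F m) + (vol (F m) * mean_osc (F m) `^ p)%:E))%E).
  apply: lee_nneseries => m _; first by rewrite mule_ge0// lee_fin.
  rewrite -!volF//; last by apply: subset_trans (WF m) (FQ0 m).
  by rewrite -!EFinM -EFinD lee_fin /c -mulrA.
rewrite nneseriesD; last 2 first.
- by move=> m _ _; rewrite mule_ge0// lee_fin powR_ge0.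
- by move=> m _ _; rewrite lee_fin mulr_ge0 ?powR_ge0// fine_ge0.
rewrite nneseriesZl// -FE measure_bigcupE//; apply: leeD => //.
by apply: JN_bound => // m; case: (Fcube m) => [?|?]; [left|right].
Qed.

(* [T = eps * lam] in [good_lambda] makes the coefficient of [phi lam] one half. *)
Let eps : R := (2 * K `^ p)^-1.

(** With [c = K^p eps^(1-p)], one step turns a bound [B M] into [B M / 2 + c M], which stays below
    [B M] for [B = K^p + 2c]; the summand [K^p] covers the starting levels. *)
Definition weak_const : R := K `^ p + 2 * (K `^ p * eps `^ (1 - p)).

Lemma weak_const_gt0 : 0 < weak_const.
Proof.
have K0 : 0 < K := lt_trans ltr01 K_gt1.
have Kp0 : 0 < K `^ p by rewrite powR_gt0.
by rewrite addr_gt0// !mulr_gt0// powR_gt0// invr_gt0 mulr_gt0.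
Qed.

Lemma maximal_level_weak lam : 0 < lam -> 
  vol Q0 * (((vol Q0)^-1 * \int[mu]_(x in Q0) g x) `^ p) <= M ->
  lam `^ p * vol (E lam) <= weak_const * M.
Proof.
move=> lam0 gM.
have V0 := vol_cube_gt0 cQ0.
set lam1 := (vol Q0)^-1 * _ in gM.
have ig := integrable_sub_polyfun P0 cQ0 (@subset_refl _ Q0).
have lam10 : 0 <= lam1.
  rewrite mulr_ge0 ?invr_ge0 ?(ltW V0)//; apply: Rintegral_ge0 => x _.
  exact: normr_ge0.
have K0 : 0 < K := lt_trans ltr01 K_gt1.
have M0 : 0 <= M by apply: le_trans gM; rewrite mulr_ge0 ?powR_ge0// ltW.
have Kp0 : 0 < K `^ p by rewrite powR_gt0.
have eps0 : 0 < eps by rewrite invr_gt0 mulr_gt0.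
have p0 : 0 <= p := ltW (lt_trans ltr01 p_gt1).
set B := weak_const.
have B0 : 0 < B := weak_const_gt0.
have mE t : measurable (E t) by exact: measurable_maximal_level.
have EQ0 t : E t `<=` Q0 by exact: maximal_level_subset.
have volE t : vol (E t) <= vol Q0.
  rewrite -lee_fin !(vol_fin mQ0 Q0oo)//.
  by apply: le_measure; rewrite ?inE.
(* Starting levels: [|E t| <= |Q0|], and the hypothesis [gM] bounds [lam1^p |Q0|]. *)
have small t : 0 < t -> t <= K * lam1 -> t `^ p * vol (E t) <= K `^ p * M.
  move=> t0 tK; apply: (@le_trans _ _ ((K * lam1) `^ p * vol Q0)).
    apply: ler_pM => //; first exact: powR_ge0.
      by rewrite fine_ge0.
    by rewrite ge0_ler_powR ?nnegrE ?(ltW t0)// mulr_ge0// ltW.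
  rewrite powRM//; last exact: ltW.
  by rewrite -mulrA ler_pM2l// mulrC.
have step t : lam1 <= t -> 0 < t -> t `^ p * vol (E t) <= B * M ->
    (K * t) `^ p * vol (E (K * t)) <= B * M.
  move=> lt t0 IH.
  have Q0small : ~ large_mean g t Q0.
    by apply/negP; rewrite -leNgt -ler_pdivrMr// mulrC.
  have := good_lambda t0 (mulr_gt0 eps0 t0) Q0small.
  rewrite !powRM ?(ltW t0) ?(ltW eps0) ?(ltW K0)//.
  set V := vol (E t) in IH *; set V' := vol (E (K * t)).
  rewrite (powR_pred p eps0); set e1 := eps `^ (p - 1).
  have -> : e1 * t `^ (p - 1) * (t * V') = e1 * (t `^ p * V').
    by rewrite (powR_pred p t0) !mulrA.
  set e2 := eps `^ (1 - p).
  have e20 : 0 < e2 by exact: powR_gt0.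
  have e12 : e2 * e1 = 1.
    by rewrite /e1 /e2 -powRD ?(gt_eqF eps0) ?implybT// addrA subrK subrr powRr0.
  have -> : e1 * eps * t `^ p * V = e1 * (eps * (t `^ p * V)) by rewrite !mulrA.
  rewrite -(ler_pM2l e20) mulrDr !(mulrA e2 e1) e12 !mul1r => H.
  have H2 : t `^ p * V' <= eps * (B * M) + e2 * M.
    by apply: (le_trans H); rewrite lerD2r ler_pM2l.
  have Ke : K `^ p * eps = 2^-1.
    by rewrite /eps invfM mulrCA mulfV ?mulr1// gt_eqF.
  rewrite -mulrA; apply: (le_trans (ler_wpM2l (ltW Kp0) H2)).
  rewrite mulrDr (mulrA (K `^ p) eps) Ke (mulrA (K `^ p) e2).
  rewrite /B /weak_const -/e2; move: (K `^ p) Kp0 (e2) M0 => k k0 c M0.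
  have := mulr_ge0 (ltW k0) M0.
  nra.
(* For [lam1 = 0] the levels [K^k lam1] never reach [lam], but then all means of [g] vanish and
   [E lam] is empty. *)
have [l10|l1n0] := eqVneq lam1 0.
  have -> : E lam = set0.
    apply/seteqP; split => // x [k [kQ]]; rewrite /large_mean.
    have cD : is_cube (dyad k x) by exact: dyad_cube.
    have : \int[mu]_(y in dyad k x) g y <= \int[mu]_(y in Q0) g y.
      apply: (le_Rintegral_subset mQ0 _ ig (measurable_cube cD) mQ0 kQ (@subset_refl _ Q0)).
      by move=> y; exact: normr_ge0.
    have -> : \int[mu]_(y in Q0) g y = 0.
      by move/eqP : l10; rewrite mulf_eq0 invr_eq0 (gt_eqF V0)/= => /eqP.
    move=> D0 /lt_le_trans/(_ D0); rewrite ltNge mulr_ge0 ?(ltW lam0)//.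
    exact: ltW (vol_cube_gt0 cD).
  by rewrite vol_set0 mulr0 mulr_ge0// ltW.
have l1_gt0 : 0 < lam1 by rewrite lt_neqAle eq_sym l1n0.
have KB : K `^ p * M <= B * M.
  by rewrite ler_wpM2r// /B /weak_const lerDl !mulr_ge0// ?(ltW Kp0)// powR_ge0.
have iter k t : 0 < t -> t <= K ^+ k * lam1 -> t `^ p * vol (E t) <= B * M.
  elim: k t => [|k IH] t t0 tk.
    apply: le_trans KB; apply: small => //; apply: (le_trans tk).
    by rewrite expr0 ler_wpM2r// ltW.
  have [tK|Kt] := leP t (K * lam1); first by apply: le_trans KB; exact: small.
  have -> : t = K * (t / K) by rewrite mulrCA mulfV ?mulr1// gt_eqF.
  have tK0 : 0 < t / K by rewrite divr_gt0.
  apply: step => //; first by rewrite ler_pdivlMr// mulrC ltW.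
  by apply: IH => //; rewrite ler_pdivrMr// mulrAC -exprSr.
have bernoulli k : 1 + k%:R * (K - 1) <= K ^+ k.
  elim: k => [|k IH]; first by rewrite mul0r addr0 expr0.
  have := ler_wpM2l (ltW K0) IH; rewrite -exprS; apply: le_trans.
  have : 0 <= k%:R * (K - 1) ^+ 2 by rewrite mulr_ge0 ?ler0n ?sqr_ge0.
  by rewrite -natr1; move: (k%:R) => u; nra.
(* Chosen so that [k (K - 1) > lam / lam1]; Bernoulli then gives [K^k lam1 > lam]. *)
pose k := (Num.truncn (lam / lam1 / (K - 1))).+1.
apply: (iter k) => //; rewrite -ler_pdivrMr//.
apply: le_trans (bernoulli k); apply: ltW; apply: (@lt_trans _ _ (k%:R * (K - 1))).
  by rewrite -ltr_pdivrMr ?subr_gt0// truncnS_gt.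
by rewrite ltrDr.
Qed.

End good_lambda_inequality.

(** * The weak-type estimate *)

Section JN_bounds.
Variables (R : realType) (n s : nat) (p alpha : R) (Q0 : set (Rn R n)) (f : Rn R n -> R).
Local Notation Rn := (Rn R n).
Local Notation mu := (lebesgue_Rn R n).
Hypotheses (p_gt0 : 0 < p) (alpha_ge0 : 0 <= alpha).
Hypotheses (cQ0 : is_cube Q0) (fi : mu.-integrable Q0 (EFin \o f)).

Lemma le_vol (Q Q' : set Rn) : is_cube Q -> is_cube Q' -> Q `<=` Q' -> vol Q <= vol Q'.
Proof.
move=> cQ cQ' QQ'; have Qoo : (mu Q' < +oo)%E.
  by move: cQ' => [a [l [b [c [l0 ->]]]]]; rewrite lebesgue_Rn_cube// ltry.
have mQ' := measurable_cube cQ'; have mQ := measurable_cube cQ.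
rewrite -lee_fin (vol_fin mQ' Qoo mQ QQ') (vol_fin mQ' Qoo mQ' (@subset_refl _ _)).
by apply: le_measure; rewrite ?inE.
Qed.

Lemma JN_term_ge0 (Q : set Rn) : (0 <= JN_term p s alpha f Q)%E.
Proof. by rewrite mule_ge0 ?poweR_ge0// lee_fin fine_ge0. Qed.

Lemma JN_termE (Q : set Rn) : is_cube Q -> Q `<=` Q0 ->
  JN_term p s alpha f Q = (vol Q * (vol Q `^ (- alpha) * mean_osc s f Q) `^ p)%:E.
Proof.
move=> cQ QQ0; have mQ := measurable_cube cQ; have mQ0 := measurable_cube cQ0.
rewrite /JN_term /mean_osc.
have fQ := integrable_dist_polyfun (minpoly s Q f) cQ (integrableS mQ0 mQ QQ0 fi).
rewrite -[X in (_ * (_ * (_ * X)) `^ p)%E]fineK; last exact: (integrable_fin_num mQ fQ).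
by [].
Qed.

(** As [alpha >= 0] and [|Q| <= |Q0|], the product [|Q0|^alpha |Q|^(-alpha)] is at least one. The
    factor [|Q0|^alpha] of the theorem originates here, as a [p]-th power. *)
Lemma vol_mean_osc_le (Q : set Rn) : is_cube Q -> Q `<=` Q0 ->
  ((vol Q * mean_osc s f Q `^ p)%:E <=
   (vol Q0 `^ (alpha * p))%:E * JN_term p s alpha f Q)%E.
Proof.
move=> cQ QQ0; rewrite JN_termE// -EFinM lee_fin.
have V0 := vol_cube_gt0 cQ; have VQ := le_vol cQ cQ0 QQ0.
have o0 : 0 <= mean_osc s f Q by rewrite mulr_ge0 ?invr_ge0 ?(ltW V0)// Rintegral_ge0.
have c0 : 0 <= vol Q `^ (- alpha) * mean_osc s f Q by exact: mulr_ge0 (powR_ge0 _ _) o0.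
rewrite mulrCA ler_pM2l// powRrM -powRM ?powR_ge0//.
apply: ge0_ler_powR; rewrite ?nnegrE ?(ltW p_gt0)//; first exact: mulr_ge0 (powR_ge0 _ _) c0.
rewrite mulrA ler_peMl// powRN ler_pdivlMr ?powR_gt0// mul1r.
by rewrite ge0_ler_powR ?nnegrE ?(ltW V0) ?(le_trans (ltW V0) VQ).
Qed.

Let JN_sup := ereal_sup [set (\esum_(Q in F) JN_term p s alpha f Q)%E
             | F in disjoint_cubes Q0].

Lemma JN_term_le_sup (Q : set Rn) : is_cube Q -> Q `<=` Q0 ->
  (JN_term p s alpha f Q <= JN_sup)%E.
Proof.
move=> cQ QQ0; apply: ereal_sup_ubound; exists [set Q].
  by split=> [_ -> //|]; by move=> A B -> ->.
by rewrite esum_set1// JN_term_ge0.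
Qed.

Lemma vol_mean_osc_sum (F : (set Rn)^nat) : trivIset setT F ->
  (forall m, F m = set0 \/ is_cube (F m) /\ F m `<=` Q0) ->
  (\sum_(m <oo) (vol (F m) * mean_osc s f (F m) `^ p)%:E <=
   (vol Q0 `^ (alpha * p))%:E * JN_sup)%E.
Proof.
(* Empty terms are discarded: the empty set is not a cube, and it is the only value a disjoint
   sequence can repeat, so [F] is injective on [N]. *)
move=> tF FP; pose N m := F m != set0.
have FN m : N m -> is_cube (F m) /\ F m `<=` Q0.
  by case: (FP m) => // F0; rewrite /N F0 eqxx.
rewrite (_ : (\sum_(m <oo) _)%E =
    (\sum_(m <oo | N m) (vol (F m) * mean_osc s f (F m) `^ p)%:E)%E); last first.
  rewrite [RHS]eseries_mkcond; apply: eq_eseriesr => m _.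
  by rewrite /N; case: eqVneq => // ->; rewrite vol_set0 mul0r.
apply: (@le_trans _ _ (\sum_(m <oo | N m)
    ((vol Q0 `^ (alpha * p))%:E * JN_term p s alpha f (F m)))%E).
  apply: lee_nneseries => [m _ _|m /FN[? ?]]; last exact: vol_mean_osc_le.
  by rewrite lee_fin mulr_ge0 ?powR_ge0// fine_ge0.
rewrite nneseriesZl => [|m _]; last exact: JN_term_ge0.
apply: lee_wpmul2l; first by rewrite lee_fin powR_ge0.
rewrite nneseries_esum => [|m _]; last exact: JN_term_ge0.
have Finj : set_inj [set m | N m] F.
  move=> m m'; rewrite !inE /= => Nm Nm' FF.
  apply: (tF m m') => //; rewrite -FF setIid.
  exact/set0P.
apply: ereal_sup_ubound; exists (F @` [set m | N m]).
  split=> [_ [m Nm <-]|]; first exact: FN.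
  move=> _ _ [m Nm <-] [m' Nm' <-] mm'; congr F; exact: tF.
by apply: reindex_esum; exact: inj_bij.
Qed.

End JN_bounds.

Lemma integrable_measurable_fun (R : realType) (n : nat) (D : set (Rn R n)) (f : Rn R n -> R) :
  (lebesgue_Rn R n).-integrable D (EFin \o f) -> measurable_fun D f.
Proof. by move=> fi; apply/measurable_EFinP; exact: (measurable_int _ fi). Qed.

Section weak_bound.
Variables (R : realType) (n : nat).
Local Notation mu := (lebesgue_Rn R n).

(** The dyadic argument runs on the half-open [Q1], whereas [P0] and the norm refer to the closed
    [Q0]; the two cubes have equal volume and differ by a null set. *)
Lemma weakL_bound (s : nat) (p alpha : R) (a : 'I_n -> R) (l : R)
    (f : Rn R n -> R) (S lam : R) :
  let Q0 := box a l (fun=> true) (fun=> false) : set (Rn R n) in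
  let g := f \- polyfun (minpoly s Q0 f) in
  0 < l -> 1 < p -> 0 <= alpha -> 0 <= S ->
  mu.-integrable Q0 (EFin \o f) ->
  ereal_sup [set (\esum_(Q in F) JN_term p s alpha f Q)%E | F in disjoint_cubes Q0] = S%:E ->
  0 < lam ->
  (lam%:E * mu [set x | Q0 x /\ (lam < `|g x|)%R] `^ p^-1 <=
   ((2 `^ p * weak_const n s p) `^ p^-1 * vol Q0 `^ alpha * S `^ p^-1)%:E)%E.
Proof.
move=> Q0 g l0 p1 al0 S0 fi SE lam0.
have p0 : 0 < p := lt_trans ltr01 p1.
have cQ0 : is_cube Q0 by exists a, l, (fun=> true), (fun=> false).
pose Q1 := box a l (fun=> true) (fun=> true) : set (Rn R n).
have cQ1 : is_cube Q1 by exists a, l, (fun=> true), (fun=> true).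
have mQ0 := measurable_cube cQ0; have mQ1 := measurable_cube cQ1.
have Q10 : Q1 `<=` Q0.
  move=> x Q1x i; have := Q1x i; rewrite !in_itv/= => /andP[-> /ltW]; exact.
have muQ0 : mu Q0 = (l ^+ n)%:E by exact: lebesgue_Rn_cube.
have muQ1 : mu Q1 = (l ^+ n)%:E by exact: lebesgue_Rn_cube.
have Q1oo : (mu Q1 < +oo)%E by rewrite muQ1 ltry.
have null : mu (Q0 `\` Q1) = 0%E.
  have -> : mu (Q0 `\` Q1) = (mu Q0 - mu Q1)%E.
    by rewrite measureD ?setIidr//; rewrite [ltLHS]muQ0 ltry.
  by rewrite muQ0 muQ1 subee.
have fi1 : mu.-integrable Q1 (EFin \o f) by exact: (integrableS mQ0 mQ1 Q10 fi).
have [P0s _] := minpolyP s cQ0 fi.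
rewrite {}/g; set P0 := minpoly s Q0 f in P0s *.
pose M := vol Q0 `^ (alpha * p) * S.
have JNb F : trivIset setT F -> (forall m, F m = set0 \/ is_cube (F m) /\ F m `<=` Q1) ->
    (\sum_(m <oo) (vol (F m) * mean_osc s f (F m) `^ p)%:E <= M%:E)%E.
  move=> tF FP; rewrite /M EFinM -SE; apply: vol_mean_osc_sum => // m.
  by case: (FP m) => [|[cF FQ]]; [left|right; split => //; exact: subset_trans FQ Q10].
have V01 : vol Q0 = vol Q1 by rewrite /vol muQ0 muQ1.
have ig0 := integrable_dist_polyfun P0 cQ0 fi.
have ig1 := integrableS mQ0 mQ1 Q10 ig0.
(* Since [P0] is the polynomial of [Q0], this mean is at most the mean oscillation of [f] on [Q0],
   controlled by the one-cube family. *)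
have gM : vol Q1 * ((vol Q1)^-1 * \int[mu]_(x in Q1) `|f x - polyfun P0 x|) `^ p <= M.
  rewrite -lee_fin; apply: (@le_trans _ _ (vol Q0 * mean_osc s f Q0 `^ p)%:E).
    have V1 := vol_cube_gt0 cQ1.
    have IQ01 : \int[mu]_(x in Q1) `|f x - polyfun P0 x| <= \int[mu]_(x in Q0) `|f x - polyfun P0 x|.
      apply: (le_Rintegral_subset mQ0 _ ig0 mQ1 mQ0 Q10 (@subset_refl _ Q0)).
      by move=> x; exact: normr_ge0.
    have I1 : 0 <= \int[mu]_(x in Q1) `|f x - polyfun P0 x|.
      by apply: Rintegral_ge0 => x _; exact: normr_ge0.
    rewrite lee_fin /mean_osc -/P0 V01; apply: (ler_wpM2l (ltW V1)).
    move: I1 IQ01; move: (Rintegral _ _ _) (Rintegral _ _ _) (vol Q1) V1 => I J v v0 I0 IJ.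
    apply: (ge0_ler_powR (ltW p0)); rewrite ?nnegrE.
    - by rewrite mulr_ge0 ?invr_ge0 ?(ltW v0).
    - by rewrite mulr_ge0 ?invr_ge0 ?(ltW v0)// (le_trans I0 IJ).
    - by rewrite ler_wpM2l// invr_ge0 ltW.
  have H := @vol_mean_osc_le R n s p alpha Q0 f p0 al0 cQ0 fi Q0 cQ0 (@subset_refl _ Q0).
  apply: (le_trans H).
  rewrite /M EFinM -SE lee_wpmul2l ?lee_fin ?powR_ge0//.
  exact: JN_term_le_sup.
(* [level_set_maximal] needs a strictly lower level; halving costs the factor [2^p]. *)
have lam2 : 0 < lam / 2 by rewrite divr_gt0.
pose E := maximal_level a l (fun x => `|f x - polyfun P0 x|) Q1 (lam / 2).
have W := maximal_level_weak l0 p1 fi1 P0s JNb lam2 gM; rewrite -/Q1 -/E in W.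
have mE : measurable E by exact: measurable_maximal_level.
have EQ1 : E `<=` Q1 by exact: maximal_level_subset.
have oQ1 : dyadic_open a l Q1.
  by move=> x Q1x; exists 0%N; rewrite (dyad0 l0 Q1x).
have level : (mu [set x | Q0 x /\ (lam < `|(f \- polyfun P0) x|)%R] <= (vol E)%:E)%E.
  rewrite (vol_fin mQ1 Q1oo mE EQ1).
  have l2 : lam / 2 < lam by rewrite ltr_pdivrMr// ltr_pMr// ltr1n.
  have L := level_set_maximal l0 mQ1 Q1oo (fun x => normr_ge0 (f x - polyfun P0 x)) ig1 oQ1 (ltW lam2) l2.
  apply: le_trans L.
  rewrite -[leRHS]adde0 -null.
  have mlevel D : measurable D -> mu.-integrable D (EFin \o (fun x => `|f x - polyfun P0 x|)) ->
      measurable [set x | D x /\ (lam < `|f x - polyfun P0 x|)%R].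
    move=> mD iD.
    have := integrable_measurable_fun iD mD (measurable_itv `]lam, +oo[).
    by congr measurable; apply/seteqP; split=> x /=; rewrite in_itv/= andbT.
  apply: (@le_trans _ _ (mu ([set x | Q1 x /\ (lam < `|f x - polyfun P0 x|)%R] `|` (Q0 `\` Q1)))).
    apply: le_measure; rewrite ?inE.
    - exact: mlevel.
    - by apply: measurableU; [exact: mlevel|exact: measurableD].
    - move=> x [Q0x gx]; have [Q1x|Q1x] := pselect (Q1 x); [by left|by right].
  by apply: measureU2; [exact: mlevel|exact: measurableD].
set X := [set x | _] in level *.
have B0 : 0 <= 2 `^ p * weak_const n s p by rewrite mulr_ge0 ?powR_ge0// ltW// weak_const_gt0.
have [v vE] : exists v, mu X = v%:E.
  exists (fine (mu X)); rewrite fineK// ge0_fin_numE//.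
  by apply: le_lt_trans level _; rewrite ltry.
have v0 : 0 <= v by rewrite -lee_fin -vE.
have vV : v <= vol E by rewrite -lee_fin -vE.
rewrite vE poweR_EFin -EFinM lee_fin.
have pV0 : 0 <= p^-1 by rewrite invr_ge0 ltW.
have rootK (u : R) : 0 <= u -> u = (u `^ p) `^ p^-1.
  by move=> u0; rewrite -powRrM mulfV ?gt_eqF// powRr1.
rewrite {1}(rootK lam (ltW lam0)) -powRM ?powR_ge0//.
have -> : vol Q0 `^ alpha = (vol Q0 `^ (alpha * p)) `^ p^-1.
  by rewrite -powRrM mulfK ?gt_eqF.
have BV0 := mulr_ge0 B0 (powR_ge0 (vol Q0) (alpha * p)).
rewrite -(powRM p^-1 B0 (powR_ge0 _ _)) -(powRM p^-1 BV0 S0).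
apply: (ge0_ler_powR pV0); rewrite ?nnegrE.
- by rewrite mulr_ge0 ?powR_ge0.
- exact: mulr_ge0 BV0 S0.
apply: (@le_trans _ _ (lam `^ p * vol E)); first by rewrite ler_wpM2l ?powR_ge0.
have -> : lam `^ p = 2 `^ p * (lam / 2) `^ p.
  by rewrite -powRM ?(ltW lam2)// mulrCA mulfV ?mulr1.
by rewrite -!mulrA ler_wpM2l ?powR_ge0.
Qed.

End weak_bound.

Theorem theorem1p21 (R : realType) (n : nat) (n_gt0 : (0 < n)%N)
    (p : R) (p_gt1 : 1 < p) (s : nat) :
  exists C : R, 0 < C /\
    forall (alpha : R) (Q0 : set (Rn R n)) (f : Rn R n -> R),
      0 <= alpha -> is_closed_cube Q0 -> JN p s alpha Q0 f ->
      weakL p Q0 (f \- polyfun (minpoly s Q0 f)) /\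
      (weakL_norm p Q0 (f \- polyfun (minpoly s Q0 f))%R <=
       (C * vol Q0 `^ alpha)%:E * JN_norm p s alpha Q0 f)%E.
Proof.
have p0 : 0 < p := lt_trans ltr01 p_gt1.
exists ((2 `^ p * weak_const n s p) `^ p^-1); split.
  by rewrite powR_gt0// mulr_gt0 ?powR_gt0// weak_const_gt0.
move=> alpha Q0 f alpha0 [a [l [l0 Q0E]]] [fi normoo].
have {Q0E}Q0E : Q0 = box a l (fun=> true) (fun=> false) by exact: Q0E.
have cQ0 : is_cube Q0 by exists a, l, (fun=> true), (fun=> false).
(* A supremum [+oo] would make the norm [+oo], since [p^-1] is nonzero; nonnegativity comes from the
   one-cube family. *)
have [S S0 SE] : exists2 S : R, 0 <= S & ereal_sup
    [set (\esum_(Q in F) JN_term p s alpha f Q)%E | F in disjoint_cubes Q0] = S%:E.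
  have := le_trans (JN_term_ge0 s p alpha f Q0)
    (JN_term_le_sup s p alpha f cQ0 (@subset_refl _ Q0)).
  move: normoo; rewrite /JN_norm; case: (ereal_sup _) => [r _ r0|+ _|//]; first by exists r.
  by rewrite poweRyr// invr_neq0// gt_eqF.
have le_norm : (weakL_norm p Q0 (f \- polyfun (minpoly s Q0 f))%R <=
    ((2 `^ p * weak_const n s p) `^ p^-1 * vol Q0 `^ alpha)%:E * JN_norm p s alpha Q0 f)%E.
  apply: ge_ereal_sup => _ [lam lam0 <-].
  rewrite /JN_norm SE poweR_EFin -EFinM.
  by rewrite Q0E in fi SE *; exact: weakL_bound.
split=> //; split.
  apply: measurable_funB; first exact: integrable_measurable_fun fi.
  by apply: measurable_funTS; exact: measurable_polyfun.
apply: le_lt_trans le_norm _.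
by rewrite /JN_norm SE poweR_EFin -EFinM ltry.
Qed.
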